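(* Let $\Delta$ be a skew-symmetric operator in $U_n$ commuting with $\hat h$, let $$\hat r^0_{\Delta,n}=\frac12\,\frac{1+\hat h\hat\tau_n}{1-\hat h\hat\tau_n}\,\mathcal P_0'+n\Delta\,\mathcal P_{U_n},\qquad \hat r_{\Delta,n}=\tfrac12(\mathcal P_+-\mathcal P_-)+\hat r^0_{\Delta,n}\mathcal P_0,$$ where $\mathcal P_{U_n}$ is the orthogonal projection operator onto $U_n$, and $(\hat r_{\Delta,n})_\pm=\hat r_{\Delta,n}\pm\frac12\mathrm{id}$. The Poisson bracket on $L\mathfrak{gl}_n$ defined by $$\{\hat\varphi,\hat\psi\}_{\Delta,n}=\left\langle\left\langle\begin{pmatrix}\hat r_{\Delta,n}&-\hat h(\hat r_{\Delta,n})_+\\(\hat r_{\Delta,n})_-\hat h^{-1}&-\hat r_{\Delta,n}\end{pmatrix}\begin{pmatrix}\nabla\hat\varphi\\\nabla'\hat\varphi\end{pmatrix},\begin{pmatrix}\nabla\hat\psi\\\nabla'\hat\psi\end{pmatrix}\right\rangle\right\rangle$$ gives rise via Drinfeld-Sokolov reduction to the following bracket on $\mathbb M_n$: $$\{\varphi,\psi\}^\Delta_n=\left\langle\left\langle\begin{pmatrix}R+\left(\frac12\frac{1+\hat h^n}{1-\hat h^n}+\Delta\right)P_0'&-\left(\frac1{1-\hat h^n}+\Delta\right)\hat h^nP_0'\\ \left(\frac{\hat h^n}{1-\hat h^n}+\Delta\right)\hat h^{-n}P_0'&R-\left(\frac12\frac{1+\hat h^n}{1-\hat h^n}+\Delta\right)P_0'\end{pmatrix}D\varphi,D\psi\right\rangle\right\rangle,$$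 where $\mathrm{End}\,U_n$ and $\mathrm{End}\,\mathbb C((z^{-1}))$ are identified.
   Context: Fix $q\in\mathbb C$, $0<|q|<1$. $\mathbb C((z^{-1}))$ is the field of formal series $a=\sum_{i\le N}a_iz^i$; $(\hat ha)(z)=a(qz)$, also written ${}^ha$; $\int a(z)\,dz/z:=a_0$. $\hat h$ acts on matrices entrywise. $L\mathfrak{gl}_n$ is the algebra of $n\times n$ matrices over $\mathbb C((z^{-1}))$ with inner product $\langle A,B\rangle=\int\frac{dz}{z}\mathrm{Tr}\,A(z)B(z)$. $\mathcal P_+,\mathcal P_-,\mathcal P_0$ are the projections onto strictly upper triangular, strictly lower triangular and diagonal ($L\mathfrak h_n$) matrices. $\mathcal P_{00}$ is the orthogonal projection onto $\mathbb C\cdot1\subset L\mathfrak h_n$ (constant multiples of the unit matrix), $\mathcal P_0'=\mathcal P_0-\mathcal P_{00}$. $\hat\tau_n\,\mathrm{diag}(f_0,\dots,f_{n-1})=\mathrm{diag}(f_1,\dots,f_{n-1},f_0)$; $1-\hat h\hat\tau_n$ is invertible on $\mathcal P_0'(L\mathfrak h_n)$ and $\frac{1+\hat h\hat\tau_n}{1-\hat h\hat\tau_n}\mathcal P_0'$ is understood using this inverse. $U_n=\{\mathrm{diag}(f_0(z),f_0(q^{-1}z),\dots,f_0(q^{-(n-1)}z)):f_0\in\mathbb C((z^{-1}))\}$; it is identified with $\mathbb C((z^{-1}))$ by taking the component $f_0$, which identifies $\mathrm{End}\,U_n$ with $\mathrm{End}\,\mathbb C((z^{-1}))$. Skew-symmetry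 is with respect to $\langle\cdot,\cdot\rangle$. A smooth functional $\hat\varphi$ on $L\mathfrak{gl}_n$ has a linear gradient $d\hat\varphi(\mathbb L)\in L\mathfrak{gl}_n$ with $\langle d\hat\varphi(\mathbb L),X\rangle=\frac{d}{dt}\big|_{t=0}\hat\varphi(\mathbb L+tX)$; $\nabla\hat\varphi=\mathbb L\,d\hat\varphi$, $\nabla'\hat\varphi=d\hat\varphi\,\mathbb L$. On a direct sum of two copies of a space with inner product, $\langle\langle(X_1,X_2)^T,(Y_1,Y_2)^T\rangle\rangle=\langle X_1,Y_1\rangle-\langle X_2,Y_2\rangle$. DS reduction: the group $L\mathbf N_+(n)$ of unipotent upper triangular matrices over $\mathbb C((z^{-1}))$ acts by $\mathbb L\mapsto{}^hS\,\mathbb L\,S^{-1}$; it preserves $\mathbb Y_n=\{\Lambda_n+A:A\text{ upper triangular}\}$, $\Lambda_n$ having ones on the first subdiagonal and zeros elsewhere. The action on $\mathbb Y_n$ is free with cross-section the companion matrices, with first row $(-u_1,\dots,-u_n)$, ones on the first subdiagonal, zeros elsewhere. Thus $\mathbb Y_n/L\mathbf N_+(n)$ is identified with $\mathbb M_n=\{L=D^n+u_1(z)D^{n-1}+\cdots+u_n(z):u_i\in\mathbb C((z^{-1}))\}$, the companion matrix corresponding to $L$; let $\rho:\mathbb Y_n\to\mathbb M_n$ be the projection. The reduced bracket on $\mathbb M_n$ is $\{\varphi,\psi\}(\rho(\mathbb L))=\{\hat\varphi,\hat\psi\}(\mathbb L)$, $\mathbb L\in\mathbb Y_n$, where $\hat\varphi,\hat\psi$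 are $L\mathbf N_+(n)$-invariant functionals on $L\mathfrak{gl}_n$ with $\hat\varphi|_{\mathbb Y_n}=\rho^*\varphi$, $\hat\psi|_{\mathbb Y_n}=\rho^*\psi$. $\mathbb M_n$ is regarded as an affine subspace of the algebra $\Psi\mathbf D_q$ of formal series $A=\sum_{i\le N(A)}a_i(z)D^i$, $a_i\in\mathbb C((z^{-1}))$, with $D\cdot a={}^ha\cdot D$. $P_+,P_0,P_-$ are the projections of $\Psi\mathbf D_q$ onto the subalgebras $J_+$, $J_0=\mathbb C((z^{-1}))$, $J_-$ of series with only positive, zero, negative powers of $D$; $R=\frac12(P_+-P_-)$; $P_0'A=P_0A-\int P_0A\,dz/z$ (the component of $P_0A$ with the constant term removed). On the image of $P_0'$ the operator $1-\hat h^n$ is invertible. $\mathrm{Tr}\,A=\int P_0A\,dz/z$ and $\langle A,B\rangle=\mathrm{Tr}\,AB$. For a smooth functional $\varphi$ on $\mathbb M_n$, the gradient $d\varphi(L)=\sum_{i=0}^{n-1}f_iD^{-i}$, $f_i\in\mathbb C((z^{-1}))$, is defined by $\langle X,d\varphi(L)\rangle=\frac{d}{dt}\big|_{t=0}\varphi(L+tX)$ for $X=\sum_{i=0}^{n-1}x_iD^i$; $\nabla\varphi=L\,d\varphi$, $\nabla'\varphi=d\varphi\,L$, $D\varphi=(\nabla\varphi,\nabla'\varphi)^T$. *)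

(* Defs.v *)
From HB Require Import structures.
From mathcomp Require Import all_boot all_order all_algebra.
From mathcomp Require Import complex zify ring.
From mathcomp Require Import all_classical all_reals all_analysis.

Set Implicit Arguments.
Unset Strict Implicit.
Unset Printing Implicit Defensive.

Import Order.TTheory GRing.Theory Num.Theory.
Import numFieldNormedType.Exports.

Local Open Scope classical_set_scope.
Local Open Scope ring_scope.

(******************************************************************************)
(* Skew Laurent series sum_(i <= N) a_i D^i over a ring A, with the           *)
(* multiplication rule D^i a = s_i(a) D^i for an action s of the group Z on A *)
(* by ring automorphisms.  With the trivial action this gives A((z^-1)); with *)
(* the action generated by a(z) |-> a(q z) on A = C((z^-1)) it gives the      *)
(* q-pseudodifference operators.                                              *)
(******************************************************************************)

Record zact (A : nzRingType) := ZAct {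
  zact_fun :> int -> {rmorphism A -> A};
  zact0 : forall a, zact_fun 0 a = a;
  zactD : forall i j a, zact_fun (i + j) a = zact_fun i (zact_fun j a)
}.

Definition bounded_above (A : nzRingType) (a : int -> A) : Prop :=
  exists N : int, forall i, N < i -> a i = 0.

Record slaurent (A : nzRingType) (s : zact A) := SLaurent {
  slcoef :> int -> A;
  slcoefP : `[< bounded_above slcoef >]
}.

HB.instance Definition _ (A : nzRingType) (s : zact A) :=
  [isSub for @slcoef A s].
HB.instance Definition _ (A : nzRingType) (s : zact A) :=
  [Choice of slaurent s by <:].

Lemma sum_triangle (V : zmodType) (F : nat -> nat -> V) (p : nat) :
  \sum_(i < p.+1) \sum_(j < (p - i).+1) F i j =
  \sum_(i < p.+1) \sum_(j < i.+1) F j (i - j)%N.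
Proof.
elim: p => [|p IHp]; first by rewrite !big_ord1.
rewrite big_ord_recr [RHS]big_ord_recr /= subnn big_ord1 -IHp.
rewrite [\sum_(j < p.+2) _]big_ord_recr /= subnn addrA -big_split /=.
congr (_ + _); apply: eq_bigr => i _.
by rewrite subSn -1?ltnS // big_ord_recr.
Qed.

Section SkewLaurent.
Variables (A : nzRingType) (s : zact A).
Implicit Types (a b c : slaurent s).

Lemma slaurentP a b : (forall i, a i = b i) -> a = b.
Proof. by move=> ab; apply: val_inj; apply: funext. Qed.

Lemma slaurent_bounded a : bounded_above a.
Proof. by case: a => f /= /asboolP. Qed.

Lemma bounded_above2 a b :
  exists N : int, forall i, N < i -> a i = 0 /\ b i = 0.
Proof.
have [N aN] := slaurent_bounded a; have [M bM] := slaurent_bounded b.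
exists (Order.max N M) => i; rewrite gt_max => /andP[Ni Mi].
by rewrite aN // bM.
Qed.

Definition sl_mk (f : int -> A) (fb : bounded_above f) : slaurent s :=
  @SLaurent A s f (asboolT fb).

Fact sl0_subproof : bounded_above (fun _ => 0 : A).
Proof. by exists 0. Qed.

Fact slopp_subproof a : bounded_above (fun i => - a i).
Proof.
by have [N aN] := slaurent_bounded a; exists N => i /aN ->; rewrite oppr0.
Qed.

Fact sladd_subproof a b : bounded_above (fun i => a i + b i).
Proof.
by have [N abN] := bounded_above2 a b; exists N => i /abN[-> ->]; rewrite addr0.
Qed.

Fact slscale_subproof (x : A) a : bounded_above (fun i => x * a i).
Proof.
by have [N aN] := slaurent_bounded a; exists N => i /aN ->; rewrite mulr0.
Qed.

Fact slmono_subproof (n : int) : bounded_above (fun i => (i == n)%:R : A).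
Proof. by exists n => i ni; rewrite gt_eqF. Qed.

Definition sl0 := sl_mk sl0_subproof.
Definition slopp a := sl_mk (slopp_subproof a).
Definition sladd a b := sl_mk (sladd_subproof a b).
Definition slscale (x : A) a := sl_mk (slscale_subproof x a).

Definition slmono (n : int) : slaurent s := sl_mk (slmono_subproof n).

Fact sladdA : associative sladd.
Proof. by move=> a b c; apply: slaurentP => i /=; rewrite addrA. Qed.
Fact sladdC : commutative sladd.
Proof. by move=> a b; apply: slaurentP => i /=; rewrite addrC. Qed.
Fact sladd0 : left_id sl0 sladd.
Proof. by move=> a; apply: slaurentP => i /=; rewrite add0r. Qed.
Fact sladdN : left_inverse sl0 slopp sladd.
Proof. by move=> a; apply: slaurentP => i /=; rewrite addNr. Qed.

HB.instance Definition _ :=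
  GRing.isZmodule.Build (slaurent s) sladdA sladdC sladd0 sladdN.

Lemma slcoef0 i : (0 : slaurent s) i = 0. Proof. by []. Qed.
Lemma slcoefD a b i : (a + b) i = a i + b i. Proof. by []. Qed.
Lemma slcoefN a i : (- a) i = - a i. Proof. by []. Qed.

(* Only finitely many summands are nonzero. *)
Definition slconv a b (k : int) : A :=
  \sum_(i \in [set: int]) a i * s i (b (k - i)).

Lemma slconvE a b (N M : int) (p : nat) :
  (forall i, N < i -> a i = 0) -> (forall i, M < i -> b i = 0) ->
  slconv a b (N + M - p%:Z) =
  \sum_(i < p.+1) a (N - i%:Z) * s (N - i%:Z) (b (M - (p - i)%N%:Z)).
Proof.
move=> aN bM; rewrite /slconv.
pose F (i : int) := a i * s i (b (N + M - p%:Z - i)).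
pose h (i : nat) : int := N - i%:Z.
have hinj : injective h by move=> i j; rewrite /h; lia.
rewrite -(@fsbig_widen _ _ _ _ (h @` `I_p.+1)) //; last first.
  move=> i [_ /= ni]; case: (ltP N i) => [/aN ->|iN]; first by rewrite mul0r.
  rewrite bM ?rmorph0 ?mulr0 //.
  have ip : (p < `|N - i|%N)%N.
    rewrite ltnNge; apply/negP => le; apply: ni; exists `|N - i|%N => //=.
    by rewrite /h; lia.
  by lia.
rewrite fsbig_image; last by move=> i j _ _; apply: hinj.
rewrite -(fsbig_ord _ _ (fun i => F (h i))); apply: eq_bigr => i _.
by congr (_ * s _ (b _)); have := ltn_ord i; rewrite /h; lia.
Qed.

Lemma slconv_gt a b (N M : int) k :
  (forall i, N < i -> a i = 0) -> (forall i, M < i -> b i = 0) ->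
  N + M < k -> slconv a b k = 0.
Proof.
move=> aN bM lt; rewrite /slconv fsbig1 // => i _.
case: (ltP N i) => [/aN ->|iN]; first by rewrite mul0r.
by rewrite bM ?rmorph0 ?mulr0 //; lia.
Qed.

Fact slmul_subproof a b : bounded_above (slconv a b).
Proof.
have [N aN] := slaurent_bounded a; have [M bM] := slaurent_bounded b.
by exists (N + M) => k; apply: slconv_gt.
Qed.

Definition slmul a b := sl_mk (slmul_subproof a b).

Lemma slmul_spec a b (N M : int) :
  (forall i, N < i -> a i = 0) -> (forall i, M < i -> b i = 0) ->
  (forall k, N + M < k -> slmul a b k = 0) /\
  forall p : nat, slmul a b (N + M - p%:Z) =
  \sum_(i < p.+1) a (N - i%:Z) * s (N - i%:Z) (b (M - (p - i)%N%:Z)).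
Proof. by move=> aN bM; split=> [k|p]; [apply: slconv_gt|apply: slconvE]. Qed.

Fact slmulA : associative slmul.
Proof.
move=> a b c; apply: slaurentP => k.
have [N aN] := slaurent_bounded a; have [M bM] := slaurent_bounded b.
have [K cK] := slaurent_bounded c.
have [ab0 abE] := slmul_spec aN bM; have [bc0 bcE] := slmul_spec bM cK.
have [abc0 abcE] := slmul_spec ab0 cK; have [abc0' abcE'] := slmul_spec aN bc0.
case: (ltP (N + M + K) k) => [lt|le].
  by rewrite abc0 // abc0' // addrA.
have [p ->] : exists p : nat, k = N + M + K - p%:Z.
  by exists `|(N + M + K - k)%R|%N; lia.
rewrite abcE -[N + M + K]addrA abcE'.
under eq_bigr => i _ do rewrite bcE rmorph_sum mulr_sumr.
under [RHS]eq_bigr => i _ do rewrite abE mulr_suml.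
pose F (i j : nat) := a (N - i%:Z) * s (N - i%:Z) (b (M - j%:Z)) *
  s (N + M - (i + j)%N%:Z) (c (K - (p - (i + j))%N%:Z)).
transitivity (\sum_(i < p.+1) \sum_(j < (p - i).+1) F i j).
  apply: eq_bigr => i _; apply: eq_bigr => j _; rewrite /F.
  rewrite rmorphM mulrA -zactD; congr (_ * s _ (c _)); last by rewrite subnDA.
  by lia.
transitivity (\sum_(i < p.+1) \sum_(j < i.+1) F j (i - j)%N); last first.
  apply: eq_bigr => i _; apply: eq_bigr => j _; rewrite /F.
  by rewrite subnKC // -ltnS.
exact: sum_triangle.
Qed.

Fact slmul1l : left_id (slmono 0) slmul.
Proof.
move=> a; apply: slaurentP => k /=; rewrite /slconv.
rewrite -(@fsbig_widen _ _ _ _ [set 0]) ?fsbig_set1 /= ?mul1r ?subr0 ?zact0 //.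
by move=> i [_ /= /eqP/negPf ->]; rewrite mul0r.
Qed.

Fact slmul1r : right_id (slmono 0) slmul.
Proof.
move=> a; apply: slaurentP => k /=; rewrite /slconv.
rewrite -(@fsbig_widen _ _ _ _ [set k]) ?fsbig_set1 /= ?subrr ?rmorph1 ?mulr1 //.
by move=> i [_ /= /eqP/negPf ik]; rewrite subr_eq0 eq_sym ik rmorph0 mulr0.
Qed.

Fact slmulDl : left_distributive slmul sladd.
Proof.
move=> a b c; apply: slaurentP => k.
have [N abN] := bounded_above2 a b; have [M cM] := slaurent_bounded c.
have aN i : N < i -> a i = 0 by move=> /abN[].
have bN i : N < i -> b i = 0 by move=> /abN[].
have dN i : N < i -> sladd a b i = 0 by move=> /abN[/= -> ->]; rewrite addr0.
have [d0 dE] := slmul_spec dN cM; have [a0 aE] := slmul_spec aN cM.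
have [b0 bE] := slmul_spec bN cM; rewrite [RHS]/=.
rewrite -[slconv a c _]/(slmul a c _) -[slconv b c _]/(slmul b c _).
case: (ltP (N + M) k) => [lt|le]; first by rewrite d0 // a0 // b0 // addr0.
have [p ->] : exists p : nat, k = N + M - p%:Z.
  by exists `|(N + M - k)%R|%N; lia.
rewrite dE aE bE -big_split; apply: eq_bigr => i _ /=.
by rewrite mulrDl.
Qed.

Fact slmulDr : right_distributive slmul sladd.
Proof.
move=> c a b; apply: slaurentP => k.
have [N abN] := bounded_above2 a b; have [M cM] := slaurent_bounded c.
have aN i : N < i -> a i = 0 by move=> /abN[].
have bN i : N < i -> b i = 0 by move=> /abN[].
have dN i : N < i -> sladd a b i = 0 by move=> /abN[/= -> ->]; rewrite addr0.
have [d0 dE] := slmul_spec cM dN; have [a0 aE] := slmul_spec cM aN.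
have [b0 bE] := slmul_spec cM bN; rewrite [RHS]/=.
rewrite -[slconv c a _]/(slmul c a _) -[slconv c b _]/(slmul c b _).
case: (ltP (M + N) k) => [lt|le]; first by rewrite d0 // a0 // b0 // addr0.
have [p ->] : exists p : nat, k = M + N - p%:Z.
  by exists `|(M + N - k)%R|%N; lia.
rewrite dE aE bE -big_split; apply: eq_bigr => i _ /=.
by rewrite rmorphD mulrDr.
Qed.

Fact slone_neq0 : slmono 0 != 0.
Proof. by apply/eqP => /(congr1 (fun a => slcoef a 0)) /eqP; rewrite /= oner_eq0. Qed.

HB.instance Definition _ := GRing.Zmodule_isNzRing.Build (slaurent s)
  slmulA slmul1l slmul1r slmulDl slmulDr slone_neq0.

Fact slscaleA x y a : slscale x (slscale y a) = slscale (x * y) a.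
Proof. by apply: slaurentP => i /=; rewrite mulrA. Qed.
Fact slscale1 : left_id 1 slscale.
Proof. by move=> a; apply: slaurentP => i /=; rewrite mul1r. Qed.
Fact slscaleDr : right_distributive slscale +%R.
Proof. by move=> x a b; apply: slaurentP => i /=; rewrite mulrDr. Qed.
Fact slscaleDl a : {morph slscale^~ a : x y / x + y}.
Proof. by move=> x y; apply: slaurentP => i /=; rewrite mulrDl. Qed.

HB.instance Definition _ := GRing.Zmodule_isLmodule.Build A (slaurent s)
  slscaleA slscale1 slscaleDr slscaleDl.

Fact slscaleAl (x : A) a b : x *: (a * b) = (x *: a) * b.
Proof.
have [N aN] := slaurent_bounded a; have [M bM] := slaurent_bounded b.
have xN i : N < i -> (x *: a) i = 0 by move=> /aN /= ->; rewrite mulr0.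
apply: slaurentP => k; have [d0 dE] := slmul_spec aN bM.
have [e0 eE] := slmul_spec xN bM; rewrite [LHS]/=.
rewrite -[slconv a b k]/(slmul a b k) -[RHS]/(slmul (x *: a) b k).
case: (ltP (N + M) k) => [lt|le]; first by rewrite d0 // e0 // mulr0.
have [p ->] : exists p : nat, k = N + M - p%:Z.
  by exists `|(N + M - k)%R|%N; lia.
by rewrite dE eE mulr_sumr; apply: eq_bigr => i _; rewrite mulrA.
Qed.

HB.instance Definition _ :=
  GRing.Lmodule_isLalgebra.Build A (slaurent s) slscaleAl.

Lemma slcoefZ (x : A) a i : (x *: a) i = x * a i. Proof. by []. Qed.
Lemma slcoefM a b k : (a * b) k = \sum_(i \in [set: int]) a i * s i (b (k - i)).
Proof. by []. Qed.

Fact sltrunc_subproof (P : pred int) a :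
  bounded_above (fun i => if P i then a i else 0).
Proof.
by have [N aN] := slaurent_bounded a; exists N => i /aN ->; case: ifP.
Qed.

Definition sltrunc (P : pred int) a := sl_mk (sltrunc_subproof P a).

End SkewLaurent.

(* laurent K below is the field K((z^-1)): a series is bounded above in powers
   of z, and its coefficient of z^i is a i. *)
Definition triv_zact (K : nzRingType) : zact K :=
  @ZAct K (fun _ => idfun) (fun _ => erefl) (fun _ _ _ => erefl).

Definition laurent (K : fieldType) := slaurent (triv_zact K).

HB.instance Definition _ (K : fieldType) := GRing.Lalgebra.on (laurent K).

Section LaurentField.
Variable K : fieldType.
Implicit Types a b : laurent K.

Fact laurent_mulC : @commutative (laurent K) (laurent K) *%R.
Proof.
move=> a b; apply: slaurentP => k.
have [N aN] := slaurent_bounded a; have [M bM] := slaurent_bounded b.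
have [d0 dE] := slmul_spec aN bM; have [e0 eE] := slmul_spec bM aN.
rewrite -[LHS]/(slmul a b k) -[RHS]/(slmul b a k).
case: (ltP (N + M) k) => [lt|le]; first by rewrite d0 // e0 // addrC.
have [p ->] : exists p : nat, k = N + M - p%:Z.
  by exists `|(N + M - k)%R|%N; lia.
rewrite dE [N + M]addrC eE (reindex_inj rev_ord_inj); apply: eq_bigr => i _ /=.
by rewrite mulrC !subSS subKn // -ltnS.
Qed.

HB.instance Definition _ :=
  GRing.PzRing_hasCommutativeMul.Build (laurent K) laurent_mulC.

(* inverse of the power series sum_k f_k x^k with f_0 != 0 *)
Fixpoint psinv_seq (f : nat -> K) (n : nat) : seq K :=
  if n is k.+1 then
    let r := psinv_seq f k in
    rcons r ((f 0%N)^-1 * ((k == 0%N)%:R - \sum_(i < k) f (k - i)%N * r`_i))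
  else [::].

Definition psinv f n := (psinv_seq f n.+1)`_n.

Lemma psinvP f : f 0%N != 0 -> forall n,
  \sum_(i < n.+1) f (n - i)%N * psinv f i = (n == 0%N)%:R.
Proof.
move=> f0 n; have sz k : size (psinv_seq f k) = k.
  by elim: k => //= k IHk; rewrite size_rcons IHk.
have nthE k i : (i < k)%N -> (psinv_seq f k)`_i = psinv f i.
  elim: k => // k IHk; rewrite ltnS leq_eqVlt => /orP[/eqP -> //|ik].
  by rewrite /= nth_rcons sz ik IHk.
rewrite big_ord_recr /= subnn {2}/psinv /= nth_rcons sz ltnn eqxx mulVKf //.
rewrite (eq_bigr (fun i : 'I_n => f (n - i)%N * (psinv_seq f n)`_i)).
  by rewrite addrC subrK.
by move=> i _; rewrite nthE.
Qed.

Fact laurent_inv_ex a : a != 0 -> exists b, b * a = 1.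
Proof.
move=> a0; have [N0 aN0] := slaurent_bounded a.
have [k ak] : exists k, a k != 0.
  apply: contrapT => /forallNP h; case/eqP: a0; apply: slaurentP => k.
  by apply/eqP; apply: contrapT => /negP; apply: h.
have exn : exists p : nat, a (N0 - p%:Z) != 0.
  exists `|(N0 - k)%R|%N; suff -> : N0 - `|(N0 - k)%R|%N%:Z = k by [].
  by case: (ltP N0 k) => [/aN0 /eqP|]; [rewrite (negPf ak)|lia].
case: (ex_minnP exn) => p ap pmin; pose N := N0 - p%:Z.
have aN i : N < i -> a i = 0.
  move=> Ni; case: (ltP N0 i) => [/aN0 //|iN].
  apply/eqP; apply: contrapT => /negP ai.
  have := pmin `|(N0 - i)%R|%N; rewrite (_ : N0 - _ = i); last by lia.
  by move=> /(_ ai); rewrite /N in Ni; lia.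
pose f (j : nat) := a (N - j%:Z).
have f0 : f 0%N != 0 by rewrite /f subr0.
pose g (i : int) := if i <= - N then psinv f `|(- N - i)%R|%N else 0.
have gb : bounded_above g by exists (- N) => i Ni; rewrite /g leNgt Ni.
pose b : laurent K := sl_mk (triv_zact K) gb.
have bN i : - N < i -> b i = 0 by move=> Ni; rewrite /= /g leNgt Ni.
exists b; apply: slaurentP => i; have [d0 dE] := slmul_spec bN aN.
rewrite -[LHS]/(slmul b a i); case: (ltP (- N + N) i) => [lt|le].
  rewrite d0 //; rewrite addNr in lt.
  by rewrite -[RHS]/((i == 0)%:R) gt_eqF.
have [r ->] : exists r : nat, i = - N + N - r%:Z.
  by exists `|i|%N; rewrite addNr in le *; lia.
rewrite dE addNr sub0r -[RHS]/((- r%:Z == 0)%:R) oppr_eq0.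
rewrite -[RHS]/((r == 0%N)%:R) -(psinvP f0 r); apply: eq_bigr => j _ /=.
rewrite mulrC; congr (_ * _); rewrite /g ifT; last by lia.
by congr psinv; lia.
Qed.

Definition laurent_inv a : laurent K := xget 0 [set b | b * a = 1].

Fact laurent_mulV a : a != 0 -> laurent_inv a * a = 1.
Proof. by move=> /laurent_inv_ex /(@xgetPex _ 0 [set b | b * a = 1]). Qed.

Fact laurent_inv0 : laurent_inv 0 = 0.
Proof.
rewrite /laurent_inv; case: xgetP => [b _ /= /eqP|//].
by rewrite mulr0 eq_sym oner_eq0.
Qed.

HB.instance Definition _ :=
  GRing.ComNzRing_isField.Build (laurent K) laurent_mulV laurent_inv0.

End LaurentField.

Section Dilation.
Variables (K : fieldType) (q : K).

Fact hpow_subproof (i : int) (a : laurent K) :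
  bounded_above (fun k => q ^ (i * k) * a k).
Proof.
by have [N aN] := slaurent_bounded a; exists N => k /aN ->; rewrite mulr0.
Qed.

(* a(z) |-> a(q^i z) *)
Definition hpow (i : int) (a : laurent K) : laurent K :=
  sl_mk (triv_zact K) (hpow_subproof i a).

End Dilation.

Section DilationAction.
Variables (K : fieldType) (q : K) (q0 : q != 0).

Fact hpow_zmod_morphism i : zmod_morphism (@hpow K q i).
Proof. by move=> a b; apply: slaurentP => k /=; rewrite mulrBr. Qed.

Fact hpow_monoid_morphism i : monoid_morphism (@hpow K q i).
Proof.
split=> [|a b]; apply: slaurentP => k.
  rewrite -[LHS]/(q ^ (i * k) * (k == 0)%:R) -[RHS]/((k == 0)%:R).
  by case: eqVneq => [->|]; rewrite ?mulr0 // expr0z mulr1.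
have [N aN] := slaurent_bounded a; have [M bM] := slaurent_bounded b.
have haN j : N < j -> hpow q i a j = 0 by move=> /aN /= ->; rewrite mulr0.
have hbM j : M < j -> hpow q i b j = 0 by move=> /bM /= ->; rewrite mulr0.
have [d0 dE] := slmul_spec aN bM; have [e0 eE] := slmul_spec haN hbM.
rewrite -[LHS]/(q ^ (i * k) * slmul a b k) -[RHS]/(slmul _ _ k).
case: (ltP (N + M) k) => [lt|le]; first by rewrite d0 // e0 // mulr0.
have [p ->] : exists p : nat, k = N + M - p%:Z.
  by exists `|(N + M - k)%R|%N; lia.
rewrite dE eE mulr_sumr; apply: eq_bigr => j _ /=.
rewrite mulrACA -expfzDr //; congr (q ^ _ * _).
have := ltn_ord j; rewrite -mulrDr => jp; congr (i * _); lia.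
Qed.

Definition hpow_rmorphism i : {rmorphism laurent K -> laurent K} :=
  HB.pack (hpow q i)
    (GRing.isZmodMorphism.Build _ _ (hpow q i) (hpow_zmod_morphism i))
    (GRing.isMonoidMorphism.Build _ _ (hpow q i) (hpow_monoid_morphism i)).

Fact hpow0 (a : laurent K) : hpow q 0 a = a.
Proof. by apply: slaurentP => k /=; rewrite mul0r expr0z mul1r. Qed.

Fact hpowD i j (a : laurent K) : hpow q (i + j) a = hpow q i (hpow q j a).
Proof. by apply: slaurentP => k /=; rewrite mulrDl expfzDr // mulrA. Qed.

Definition h_zact : zact (laurent K) :=
  @ZAct (laurent K) hpow_rmorphism hpow0 hpowD.

End DilationAction.

(* The parameter t is real; the real and imaginary parts are differentiated
   separately. *)
Definition deriv_at0 (R : realType) (f : R -> R[i]) (d : R[i]) : Prop :=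
  is_derive (0 : R) (1 : R) (fun t => complex.Re (f t)) (complex.Re d) /\
  is_derive (0 : R) (1 : R) (fun t => complex.Im (f t)) (complex.Im d).

Definition pair2 (T : Type) (K : zmodType) (B : T -> T -> K) (X Y : T * T) : K :=
  B X.1 Y.1 - B X.2 Y.2.

(* a 2 x 2 matrix of operators acting on columns *)
Definition opmx2 (T : zmodType) (a11 a12 a21 a22 : T -> T) (X : T * T) : T * T :=
  (a11 X.1 + a12 X.2, a21 X.1 + a22 X.2).

(* the integral of a(z) dz / z *)
Definition intdz (K : fieldType) (a : laurent K) : K := a 0.

Section LoopAlgebra.
Variables (R : realType) (q : R[i]) (m : nat).
Local Notation C := R[i].
Local Notation n := m.+1.
Local Notation F := (laurent C).
Local Notation Lgl := 'M[F]_n.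
Implicit Types (X Y A S L : Lgl).

Definition mxpair A B : C := intdz (\tr (A *m B)).

Definition hmx (i : int) A : Lgl := map_mx (hpow q i) A.

Definition Pplus A : Lgl := \matrix_(i, j) if (i < j)%N then A i j else 0.
Definition Pminus A : Lgl := \matrix_(i, j) if (j < i)%N then A i j else 0.
Definition Pdiag A : Lgl := \matrix_(i, j) if i == j then A i j else 0.

(* orthogonal projection onto a subspace V on which the pairing is
   nondegenerate *)
Definition orth_proj (V : set Lgl) X : Lgl :=
  xget 0 [set Y | V Y /\ forall Z, V Z -> mxpair (X - Y) Z = 0].

Definition P00 : Lgl -> Lgl :=
  orth_proj [set X | exists c : C, X = (c%:A : F)%:M].
Definition Pdiag' A : Lgl := Pdiag A - P00 (Pdiag A).

Definition tau A : Lgl := diag_mx (\row_i A (ordS i) (ordS i)).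
Definition htau A : Lgl := hmx 1 (tau A).

(* (1 - h tau)^-1 on the image of P_0' *)
Definition inv_1_htau : Lgl -> Lgl :=
  'pinv_(fun=> 0) (range Pdiag') (fun A => A - htau A).

Definition embU (f : F) : Lgl := diag_mx (\row_(i < n) hpow q (- i%:Z) f).
Definition Un : set Lgl := range embU.

(* The values of Delta outside U_n are irrelevant. *)
Record skew_operator_in_Un (Delta : Lgl -> Lgl) : Prop := {
  Un_stable : forall X, Un X -> Un (Delta X);
  Un_linear : forall (c : C) X Y, Un X -> Un Y ->
    Delta ((c%:A : F) *: X + Y) = (c%:A : F) *: Delta X + Delta Y;
  Un_skew : forall X Y, Un X -> Un Y ->
    mxpair (Delta X) Y = - mxpair X (Delta Y);
  Un_commute : forall X, Un X -> Delta (hmx 1 X) = hmx 1 (Delta X)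
}.

(* the identification of End U_n with End C((z^-1)) by the component f_0 *)
Definition End_Un_laurent (Delta : Lgl -> Lgl) (f : F) : F :=
  Delta (embU f) ord0 ord0.

Section RMatrix.
Variable Delta : Lgl -> Lgl.

Definition rhat0 A : Lgl :=
  let B := inv_1_htau (Pdiag' A) in
  2^-1 *: (B + htau B) + n%:R *: Delta (orth_proj Un A).
Definition rhat A : Lgl := 2^-1 *: (Pplus A - Pminus A) + rhat0 (Pdiag A).
Definition rhat_plus A : Lgl := rhat A + 2^-1 *: A.
Definition rhat_minus A : Lgl := rhat A - 2^-1 *: A.

End RMatrix.

Definition is_mxgrad (phi : Lgl -> C) L (g : Lgl) : Prop :=
  forall X, deriv_at0 (fun t : R => phi (L + (t%:C%C%:A : F) *: X)) (mxpair g X).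
Definition mxgrad (phi : Lgl -> C) L : Lgl := xget 0 [set g | is_mxgrad phi L g].
Definition smooth_mx (phi : Lgl -> C) : Prop := forall L, exists g, is_mxgrad phi L g.

Definition mxDgrad (phi : Lgl -> C) L : Lgl * Lgl :=
  (L *m mxgrad phi L, mxgrad phi L *m L).

Definition mxbracket (Delta : Lgl -> Lgl) (phi psi : Lgl -> C) L : C :=
  pair2 mxpair
    (opmx2 (rhat Delta)
           (fun A => - hmx 1 (rhat_plus Delta A))
           (fun A => rhat_minus Delta (hmx (-1) A))
           (fun A => - rhat Delta A)
       (mxDgrad phi L))
    (mxDgrad psi L).

Definition LNplus : set Lgl :=
  [set S | forall i j : 'I_n, (j <= i)%N -> S i j = (i == j)%:R].
Definition gauge S L : Lgl := hmx 1 S *m L *m invmx S.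
Definition LNplus_invariant (phi : Lgl -> C) : Prop :=
  forall S L, LNplus S -> phi (gauge S L) = phi L.

Definition Lambda : Lgl := \matrix_(i, j) (i == j.+1 :> nat)%:R.
Definition Yn : set Lgl :=
  [set L | exists A, (forall i j : 'I_n, (j < i)%N -> A i j = 0) /\ L = Lambda + A].

(* u j stands for u_(j + 1) *)
Definition companion (u : 'I_n -> F) : Lgl :=
  \matrix_(i, j) if i == ord0 then - u j else (i == j.+1 :> nat)%:R.

End LoopAlgebra.

Section PsiDq.
Variables (R : realType) (q : R[i]).
Local Notation C := R[i].
Local Notation F := (laurent C).

Fact q_neq0 : 0 < `|q| < 1 -> q != 0.
Proof. by case/andP; rewrite normr_gt0. Qed.

Definition PsiD (hq : 0 < `|q| < 1) := slaurent (h_zact (q_neq0 hq)).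

HB.instance Definition _ hq := GRing.Lalgebra.on (PsiD hq).

Variables (hq : 0 < `|q| < 1) (m : nat).
Local Notation n := m.+1.
Local Notation Psi := (PsiD hq).
Implicit Types (A B L : Psi).

Definition Dp (i : int) : Psi := slmono (h_zact (q_neq0 hq)) i.

Definition psipos A : Psi := sltrunc (fun i => 0 < i) A.
Definition psineg A : Psi := sltrunc (fun i => i < 0) A.
Definition psi0 A : F := slcoef A 0.
Definition Rop A : Psi := 2^-1 *: (psipos A - psineg A).

Definition psiTr A : C := intdz (psi0 A).
Definition psipair A B : C := psiTr (A * B).

(* a(z) with its constant term removed, and P_0' *)
Definition rmconst (a : F) : F := a - (intdz a)%:A.
Definition psi0' A : F := rmconst (psi0 A).

(* (1 - h^n)^-1 on the image of P_0' *)
Definition inv_1_hn : F -> F :=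
  'pinv_(fun=> 0) (range psi0') (fun a => a - hpow q n a).

(* u j stands for u_(j + 1) *)
Definition Lop (u : 'I_n -> F) : Psi :=
  Dp n + \sum_(j < n) u j *: Dp (n - j.+1)%N.
Definition Mn : set Psi := range Lop.

(* Functionals on M_n are represented by functions on PsiD; only their values
   on M_n are used. *)
Definition is_psigrad (phi : Psi -> C) L (g : Psi) : Prop :=
  (exists f : 'I_n -> F, g = \sum_(i < n) f i *: Dp (- i%:Z)) /\
  forall x : 'I_n -> F, let X := \sum_(i < n) x i *: Dp i in
    deriv_at0 (fun t : R => phi (L + (t%:C%C%:A : F) *: X)) (psipair X g).
Definition psigrad (phi : Psi -> C) L : Psi := xget 0 [set g | is_psigrad phi L g].
Definition smooth_Mn (phi : Psi -> C) : Prop :=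
  forall L, Mn L -> exists g, is_psigrad phi L g.

Definition psiDgrad (phi : Psi -> C) L : Psi * Psi :=
  (L * psigrad phi L, psigrad phi L * L).

Section Bracket.
Variable delta : F -> F.

Definition op_half (a : F) : F :=
  2^-1 *: (inv_1_hn a + hpow q n (inv_1_hn a)) + delta a.
Definition op_plus (a : F) : F := inv_1_hn a + delta a.
Definition op_minus (a : F) : F := hpow q n (inv_1_hn a) + delta a.

Definition psibracket (phi psi : Psi -> C) L : C :=
  pair2 psipair
    (opmx2 (fun A => Rop A + (op_half (psi0' A))%:A)
           (fun A => - (op_plus (hpow q n (psi0' A)))%:A)
           (fun A => (op_minus (hpow q (- n%:Z) (psi0' A)))%:A)
           (fun A => Rop A - (op_half (psi0' A))%:A)
       (psiDgrad phi L))
    (psiDgrad psi L).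

End Bracket.

(* S and u are unique for L in Y_n: the action is free and the companion
   matrices form a cross-section. *)
Definition rho (L : 'M[F]_n) : Psi :=
  xget 0 [set M | exists S u, [/\ LNplus S, gauge q S L = companion u & M = Lop u]].

(* Drinfeld-Sokolov reduction: br1 is evaluated on arbitrary invariant
   extensions of the pullbacks of phi and psi along rho. *)
Definition DS_reduces_to
    (br1 : ('M[F]_n -> C) -> ('M[F]_n -> C) -> 'M[F]_n -> C)
    (br2 : (Psi -> C) -> (Psi -> C) -> Psi -> C) : Prop :=
  forall (phi psi : Psi -> C) (phih psih : 'M[F]_n -> C),
    smooth_Mn phi -> smooth_Mn psi ->
    smooth_mx phih -> smooth_mx psih ->
    LNplus_invariant q phih -> LNplus_invariant q psih ->
    (forall L : 'M[F]_n, Yn L -> phih L = phi (rho L)) ->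
    (forall L : 'M[F]_n, Yn L -> psih L = psi (rho L)) ->
    forall L : 'M[F]_n, Yn L -> br2 phi psi (rho L) = br1 phih psih L.

End PsiDq.

Arguments psibracket {R q} hq m delta phi psi L.
Arguments DS_reduces_to {R q} hq {m} br1 br2.

(* Main.v *)
Require Import Defs.
From mathcomp Require Import all_boot all_order all_algebra.
From mathcomp Require Import complex zify ring.
From mathcomp Require Import all_classical all_reals all_analysis.

Set Implicit Arguments.
Unset Strict Implicit.
Unset Printing Implicit Defensive.

Import Order.TTheory GRing.Theory Num.Theory.
Import numFieldNormedType.Exports.
Local Open Scope classical_set_scope.
Local Open Scope ring_scope.

(** The bracket on the loop algebra is evaluated at a point of [Yn] on two
gauge invariant functionals, and the result is rewritten until it is the
reduced bracket.  Write [d] for the gradient of one functional at [L],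
[A = h^-1 (L d)], [A' = d L] and [a = A - A'], and [B], [B'], [b] for the other.

Since the r-matrix commutes with [h] and [h] preserves the pairing, the bracket
equals [<r a, b> + (<A, B'> - <A', B>) / 2] ([mxbracketE]).  Invariance under
unipotent gauge transformations forces [a] and [b] to be upper triangular
([gap_grad_upper]), so only their diagonals enter [<r a, b>].  Two reductions
follow.  A gauge transformation conjugates [A], [A'] and [a] by a unipotent
matrix, which changes neither the pairings nor the diagonals
([loop_form_gauge]); hence [L] may be taken to be a companion matrix.  A strictly
upper triangular change of [d] does not change the value
([loop_form_mod_strictly_upper]); this is as it should be, because the values of
the functional on [Yn] leave that part of [d] undetermined.  The reason is the
skew-symmetry of the Cayley transform: such a change [e] alters the diagonal of
[a] by [x - h tau x], with [x] the diagonal of [h^-1 (L e)] and [h tau x] the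
diagonal of [e L].

At the companion matrix of an operator, from now on called [L = D^n + ...], the
first column of [d] consists of the coefficients of the gradient [g] of the
reduced functional, up to sign and dilations ([mxgrad_col0]), and [d] can be normalized so that only the first row of [a] is nonzero
([gap_grad_normal_form]).  A row [v] is read as the operator
[sum_j v_j D^(n-j)]; multiplication by the companion matrix becomes
multiplication by [D] modulo left multiples of [L] ([row_op_step]), so the
normalization of [d] is a division with remainder by [L].  It yields
[L (gL)_+ - (Lg)_+ L] for the first row of [a] ([row_op_first_row]), whose top
coefficient is [(Lg)_0 - h^n (gL)_0] ([first_row_top]).  The part of the loop
bracket without r-matrix is then a combination of traces of [Lg], [gL] and their
analogues for the second functional ([mxpair_first_row]).  On a diagonal matrix
with a single entry [y] the operator [1 - h tau] is inverted by a geometric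
sequence starting with [(1 - h^n)^-1 y] ([geometric_row_solve]); this is how
[h^n] enters the reduced bracket.  An elementary computation with the pairing
shows that the reduced bracket has the same value ([reduced_form_eval]).

Differentiability is only available along straight lines, whereas gauge orbits
are curved.  Two facts make this sufficient: companion matrices form an affine
space, and for a multiple [N] of an elementary matrix the point
[L + t (h N L - L N)] is gauge equivalent to [L + t^2 h N L N]
([gauge_shear], [deriv_at0_sqr]). *)

(** * Skew Laurent series *)

Section SkewLaurentSeries.
Variables (A : nzRingType) (s : zact A).
Implicit Types a b : slaurent s.

Lemma slcoefB a b i : (a - b) i = a i - b i. Proof. by []. Qed.

Lemma slcoef_sum (I : Type) (r : seq I) (P : pred I) (F : I -> slaurent s) k :
  (\sum_(i <- r | P i) F i) k = \sum_(i <- r | P i) F i k.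
Proof. by elim/big_rec2: _ => // i x y _ <-. Qed.

Lemma slcoef_mono i k : slmono s i k = (k == i)%:R.
Proof. by []. Qed.

Lemma slcoefM_supp a b (D : set int) k :
  (forall i, ~ D i -> a i * s i (b (k - i)) = 0) ->
  (a * b) k = \sum_(i \in D) a i * s i (b (k - i)).
Proof.
move=> h; rewrite slcoefM; apply/esym/fsbig_widen => // i [_ /=].
by move=> /h.
Qed.

Lemma slcoef_monoM p b k : (slmono s p * b) k = s p (b (k - p)).
Proof.
rewrite (slcoefM_supp (D := [set p])) ?fsbig_set1 ?slcoef_mono ?eqxx ?mul1r //.
by move=> i ip; rewrite slcoef_mono (negPf (introN eqP ip)) mul0r.
Qed.

Lemma slcoefMmono a p k : (a * slmono s p) k = a (k - p).
Proof.
rewrite (slcoefM_supp (D := [set k - p])) ?fsbig_set1.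
  by rewrite slcoef_mono subKr eqxx rmorph1 mulr1.
move=> i h; rewrite slcoef_mono; case: eqVneq => [e|_].
  by case: h => /=; lia.
by rewrite rmorph0 mulr0.
Qed.

Lemma slmonoM i j : slmono s i * slmono s j = slmono s (i + j).
Proof.
apply: slaurentP => k; rewrite slcoefMmono !slcoef_mono.
by rewrite subr_eq.
Qed.

Lemma slmonoZM i c b : slmono s i * (c *: b) = s i c *: (slmono s i * b).
Proof.
apply: slaurentP => k; rewrite slcoef_monoM !slcoefZ slcoef_monoM.
by rewrite rmorphM.
Qed.

Lemma slcoef_scal (c : A) k : (c%:A : slaurent s) k = c * (k == 0)%:R.
Proof. by []. Qed.

Lemma slcoefM_top a b N M :
  (forall i, N < i -> a i = 0) -> (forall i, M < i -> b i = 0) ->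
  (a * b) (N + M) = a N * s N (b M).
Proof.
move=> aN bM; have [_ /(_ 0%N)] := slmul_spec aN bM.
by rewrite subr0 big_ord1 /= subn0 !subr0.
Qed.

End SkewLaurentSeries.

(** * Dilations and the residue pairing *)

Section Dilations.
Variable (R : realType) (q : R[i]).
Hypothesis hq : 0 < `|q| < 1.
Local Notation C := R[i].
Local Notation F := (laurent C).
Local Notation h := (hpow q).
Implicit Types a b : F.

Let q0 : q != 0 := q_neq0 hq.
Let hr i : {rmorphism F -> F} := hpow_rmorphism q0 i.

Lemma hpowDr i a b : h i (a + b) = h i a + h i b. Proof. exact: (rmorphD (hr i)). Qed.
Lemma hpowB i a b : h i (a - b) = h i a - h i b. Proof. exact: (rmorphB (hr i)). Qed.
Lemma hpow_0 i : h i 0 = 0. Proof. exact: (rmorph0 (hr i)). Qed.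
Lemma hpow_1 i : h i 1 = 1. Proof. exact: (rmorph1 (hr i)). Qed.
Lemma hpowM i a b : h i (a * b) = h i a * h i b. Proof. exact: (rmorphM (hr i)). Qed.
Lemma hpow_sum i (I : Type) (r : seq I) (P : pred I) (G : I -> F) :
  h i (\sum_(j <- r | P j) G j) = \sum_(j <- r | P j) h i (G j).
Proof. exact: (rmorph_sum (hr i)). Qed.
Lemma hpow_hpow i j a : h i (h j a) = h (i + j) a.
Proof. by rewrite hpowD. Qed.
Lemma hpow_id a : h 0 a = a. Proof. exact: hpow0. Qed.
Lemma hpowK i a : h i (h (- i) a) = a.
Proof. by rewrite hpow_hpow subrr hpow_id. Qed.
Lemma hpowVK i a : h (- i) (h i a) = a.
Proof. by rewrite hpow_hpow addNr hpow_id. Qed.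
Lemma hpow_cst i (c : C) : h i (c%:A : F) = c%:A.
Proof.
apply: slaurentP => k; rewrite [LHS]/= !slcoef_scal.
by case: eqVneq => [->|]; rewrite ?mulr0 ?expr0z ?mul1r.
Qed.

Lemma scalA_nat k : (k%:R : F) = (k%:R : C)%:A.
Proof. by rewrite scaler_nat. Qed.

Lemma scalA_natV k : (k%:R^-1 : F) = (k%:R^-1 : C)%:A.
Proof.
have [->|k0] := eqVneq k 0%N; first by rewrite !invr0 scale0r.
have kC : (k%:R : C) != 0 by rewrite pnatr_eq0.
have kF : (k%:R : F) != 0.
  apply/eqP => /(congr1 (fun x : F => x 0)) /eqP.
  by rewrite scalA_nat slcoef_scal eqxx mulr1 (negPf kC).
apply: (mulfI kF); rewrite mulfV // scalA_nat.
by rewrite -scalerAl mul1r scalerA mulfV // scale1r.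
Qed.

Lemma hpowV_nat i k : h i (k%:R^-1) = k%:R^-1 :> F.
Proof. by rewrite scalA_natV hpow_cst. Qed.

Lemma intdzD a b : intdz (a + b) = intdz a + intdz b. Proof. by []. Qed.
Lemma intdzB a b : intdz (a - b) = intdz a - intdz b. Proof. by []. Qed.
Lemma intdzN a : intdz (- a) = - intdz a. Proof. by []. Qed.
Lemma intdz0 : intdz (0 : F) = 0. Proof. by []. Qed.
Lemma intdz_sum (I : Type) (r : seq I) (P : pred I) (G : I -> F) :
  intdz (\sum_(j <- r | P j) G j) = \sum_(j <- r | P j) intdz (G j).
Proof. exact: slcoef_sum. Qed.
Lemma intdzZ (c : C) a : intdz (c *: a) = c * intdz a. Proof. by []. Qed.
Lemma intdz_scalA (c : C) a : intdz (c%:A * a) = c * intdz a.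
Proof. by rewrite -scalerAl mul1r. Qed.
Lemma intdzVn k a : intdz (k%:R^-1 * a) = k%:R^-1 * intdz a.
Proof. by rewrite scalA_natV intdz_scalA. Qed.
Lemma intdz_cst (c : C) : intdz (c%:A : F) = c.
Proof. by rewrite /intdz slcoef_scal eqxx mulr1. Qed.
(** The measure [dz / z] is invariant under dilations of [z]. *)
Lemma intdz_hpow i a : intdz (h i a) = intdz a.
Proof. by rewrite /intdz /= mulr0 expr0z mul1r. Qed.
Lemma intdz_nondeg a : (forall b, intdz (a * b) = 0) -> a = 0.
Proof.
move=> ab; apply: slaurentP => k; have := ab (slmono _ (- k)).
by rewrite /intdz slcoefMmono opprK add0r.
Qed.

Lemma q_neq1 (k : int) : k != 0 -> q ^ k != 1.
Proof.
have main (j : nat) : (0 < j)%N -> q ^+ j != 1.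
  move=> j0; apply/eqP => /(congr1 Num.norm); rewrite normr1 normrX => /eqP.
  case/andP: hq => _ q1; apply/negP; rewrite lt_eqF //.
  by rewrite exprn_ilt1 // -lt0n.
case: k => j j0; first by apply: main; rewrite lt0n.
by rewrite -[q ^ _]/((q ^+ j.+1)^-1) invr_eq1 main.
Qed.

(** The inverse of [1 - h^n] multiplies the coefficient of [z^k] by
[(1 - q^(n k))^-1].  The inverse of [0] being [0], this formula also kills
constant terms, so it defines an operator on all series that commutes with [h]. *)
Section InverseOneMinusDilation.
Variable n : nat.
Fact inv1h_subproof a : bounded_above (fun k => (1 - q ^ (n%:Z * k))^-1 * a k).
Proof. by have [N aN] := slaurent_bounded a; exists N => k /aN ->; rewrite mulr0. Qed.

Definition inv1h a : F := sl_mk (triv_zact C) (inv1h_subproof a).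

Lemma inv1h_const a : intdz (inv1h a) = 0.
Proof. by rewrite /intdz /= mulr0 expr0z subrr invr0 mul0r. Qed.

Lemma inv1hK a : (0 < n)%N -> intdz a = 0 -> inv1h a - h n (inv1h a) = a.
Proof.
move=> n0 a0; apply: slaurentP => k; rewrite slcoefB /=.
have [->|k0] := eqVneq k 0; first by rewrite [a 0]a0 !mulr0 subr0.
have nz : 1 - q ^ (n%:Z * k) != 0.
  by rewrite subr_eq0 eq_sym q_neq1 // mulf_neq0 //; case: (n) n0.
by rewrite -[X in X - _]mul1r -mulrBl mulVKf.
Qed.

Lemma inv1hB a b : inv1h (a - b) = inv1h a - inv1h b.
Proof. by apply: slaurentP => k /=; rewrite mulrBr. Qed.
Lemma inv1h_hpow i a : inv1h (h i a) = h i (inv1h a).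
Proof. by apply: slaurentP => k /=; rewrite mulrCA. Qed.

End InverseOneMinusDilation.

(** As [q] is not a root of unity, [q^(n k) = 1] only for [k = 0]. *)
Lemma hpow_fixed (n : nat) a : (0 < n)%N -> h n a = a -> a = (intdz a)%:A.
Proof.
move=> n0 ha; apply: slaurentP => k; rewrite slcoef_scal.
have [->|k0] := eqVneq k 0; first by rewrite mulr1.
have /eqP := congr1 (fun x : F => x k) ha.
rewrite /= -subr_eq0 -{2}[a k]mul1r -mulrBl mulf_eq0 subr_eq0.
rewrite (negPf (q_neq1 _)) ?mulr0 => [/eqP //|].
by rewrite mulf_neq0 //; case: (n) n0.
Qed.

End Dilations.

#[local] Arguments intdz : simpl never.

(** * The trace pairing on loop matrices *)

Section MatrixPairing.
Variables (R : realType) (q : R[i]) (m : nat).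
Hypothesis hq : 0 < `|q| < 1.
Local Notation C := R[i].
Local Notation n := m.+1.
Local Notation F := (laurent C).
Local Notation Lgl := 'M[F]_n.
Local Notation h := (hpow q).
Local Notation hmx := (@hmx R q m).
Implicit Types (A B X Y : Lgl) (x y : 'rV[F]_n) (f g : F).

Lemma mxpairE A B : mxpair A B = \sum_i \sum_j intdz (A i j * B j i).
Proof.
rewrite /mxpair /mxtrace intdz_sum; apply: eq_bigr => i _.
by rewrite mxE intdz_sum.
Qed.

Lemma mxpairC A B : mxpair A B = mxpair B A.
Proof. by rewrite /mxpair mxtrace_mulC. Qed.
Lemma mxpairDl A B X : mxpair (A + B) X = mxpair A X + mxpair B X.
Proof. by rewrite /mxpair mulmxDl mxtraceD intdzD. Qed.
Lemma mxpairDr X A B : mxpair X (A + B) = mxpair X A + mxpair X B.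
Proof. by rewrite !(mxpairC X) mxpairDl. Qed.
Lemma mxpairNl A X : mxpair (- A) X = - mxpair A X.
Proof. by rewrite /mxpair mulNmx -scaleN1r mxtraceZ mulN1r intdzN. Qed.
Lemma mxpairNr X A : mxpair X (- A) = - mxpair X A.
Proof. by rewrite !(mxpairC X) mxpairNl. Qed.
Lemma mxpairBl A B X : mxpair (A - B) X = mxpair A X - mxpair B X.
Proof. by rewrite mxpairDl mxpairNl. Qed.
Lemma mxpairBr X A B : mxpair X (A - B) = mxpair X A - mxpair X B.
Proof. by rewrite mxpairDr mxpairNr. Qed.
Lemma mxpairVl k A X : mxpair ((k%:R^-1 : F) *: A) X = k%:R^-1 * mxpair A X.
Proof. by rewrite /mxpair -scalemxAl mxtraceZ intdzVn. Qed.
Lemma mxpairA A B X : mxpair (A *m B) X = mxpair A (B *m X).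
Proof. by rewrite /mxpair mulmxA. Qed.
Lemma mxpair_cyc A B X : mxpair (A *m B) X = mxpair B (X *m A).
Proof. by rewrite mxpairC -mxpairA mxpairC. Qed.
Lemma mxpair_deltar A b i j : mxpair A (b *: delta_mx j i) = intdz (A i j * b).
Proof.
rewrite mxpairE (bigD1 i) //= (bigD1 j) //= !mxE !eqxx mulr1.
rewrite [X in _ + X + _]big1 ?addr0; last first.
  by move=> k kN; rewrite !mxE (negPf kN) andFb !mulr0 intdz0.
rewrite big1 ?addr0 // => k kN; apply: big1 => l _.
by rewrite !mxE (negPf kN) andbF !mulr0 intdz0.
Qed.

Lemma mxpair_nondeg A : (forall X, mxpair A X = 0) -> A = 0.
Proof.
move=> A0; apply/matrixP => i j; rewrite mxE; apply: intdz_nondeg => b.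
by rewrite -mxpair_deltar A0.
Qed.

Lemma hmxE i A j k : hmx i A j k = h i (A j k). Proof. by rewrite mxE. Qed.
Lemma hmxM i A B : hmx i (A *m B) = hmx i A *m hmx i B.
Proof. exact: (map_mxM (hpow_rmorphism (q_neq0 hq) i)). Qed.
Lemma hmxD i A B : hmx i (A + B) = hmx i A + hmx i B.
Proof. exact: (map_mxD (hpow_rmorphism (q_neq0 hq) i)). Qed.
Lemma hmxN i A : hmx i (- A) = - hmx i A.
Proof. exact: (map_mxN (hpow_rmorphism (q_neq0 hq) i)). Qed.
Lemma hmxB i A B : hmx i (A - B) = hmx i A - hmx i B.
Proof. by rewrite hmxD hmxN. Qed.
Lemma hmx1 i : hmx i 1%:M = 1%:M.
Proof. exact: (map_mx1 (hpow_rmorphism (q_neq0 hq) i)). Qed.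
Lemma hmxZ i f A : hmx i (f *: A) = h i f *: hmx i A.
Proof. exact: (map_mxZ (hpow_rmorphism (q_neq0 hq) i)). Qed.
Lemma hmxVZ i k A : hmx i ((k%:R^-1 : F) *: A) = (k%:R^-1 : F) *: hmx i A.
Proof. by rewrite hmxZ hpowV_nat. Qed.
Lemma hmxK i A : hmx i (hmx (- i) A) = A.
Proof. by apply/matrixP => k l; rewrite !hmxE hpowK. Qed.
Lemma hmxVK i A : hmx (- i) (hmx i A) = A.
Proof. by apply/matrixP => k l; rewrite !hmxE hpowVK. Qed.

Lemma mxpair_hmx i A B : mxpair (hmx i A) (hmx i B) = mxpair A B.
Proof.
rewrite !mxpairE; apply: eq_bigr => k _; apply: eq_bigr => l _.
by rewrite !hmxE -hpowM // intdz_hpow.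
Qed.

(** * Diagonal matrices and the orthogonal projections *)

Definition diag_row A : 'rV[F]_n := \row_i A i i.

Lemma mxpair_diag x B : mxpair (diag_mx x) B = \sum_i intdz (x 0 i * B i i).
Proof.
rewrite mxpairE; apply: eq_bigr => i _; rewrite (bigD1 i) //= mxE eqxx mulr1n.
by rewrite big1 ?addr0 // => j ji; rewrite mxE eq_sym (negPf ji) mulr0n mul0r.
Qed.

(** The pairing of a diagonal matrix, given by its row of entries, with [1]. *)
Definition vtrace x : C := \sum_i intdz (x 0 i).

Lemma vtraceD x y : vtrace (x + y) = vtrace x + vtrace y.
Proof. by rewrite /vtrace -big_split; apply: eq_bigr => i _; rewrite mxE. Qed.
Lemma vtraceN x : vtrace (- x) = - vtrace x.
Proof. by rewrite /vtrace -sumrN; apply: eq_bigr => i _; rewrite mxE. Qed.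
Lemma vtraceB x y : vtrace (x - y) = vtrace x - vtrace y.
Proof. by rewrite vtraceD vtraceN. Qed.
Definition scalar_row (c : C) : 'rV[F]_n := const_mx (c%:A).
Lemma vtrace_cst c : vtrace (scalar_row c) = n%:R * c.
Proof.
rewrite /vtrace (eq_bigr (fun=> c)); last by move=> i _; rewrite mxE intdz_cst.
by rewrite sumr_const card_ord mulr_natl.
Qed.

Definition vmean x : C := n%:R^-1 * vtrace x.

Lemma nC_neq0 : (n%:R : C) != 0. Proof. by rewrite pnatr_eq0. Qed.

Lemma vtrace_mean x : vtrace (x - scalar_row (vmean x)) = 0.
Proof. by rewrite vtraceB vtrace_cst /vmean mulVKf ?subrr // nC_neq0. Qed.

Lemma Pdiag_diag_row A : Pdiag A = diag_mx (diag_row A).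
Proof.
by apply/matrixP => i j; rewrite !mxE; case: eqVneq => [->|].
Qed.
Lemma diag_rowK x : diag_row (diag_mx x) = x.
Proof. by apply/rowP => i; rewrite !mxE eqxx. Qed.

Lemma diag_mxB x y : diag_mx (x - y) = diag_mx x - diag_mx y :> Lgl.
Proof. exact: raddfB. Qed.
Lemma diag_mxD x y : diag_mx (x + y) = diag_mx x + diag_mx y :> Lgl.
Proof. exact: raddfD. Qed.
Lemma diag_rowB A B : diag_row (A - B) = diag_row A - diag_row B.
Proof. by apply/rowP => i; rewrite !mxE. Qed.
(** The last hypothesis, nondegeneracy of the pairing on [V], makes the element
chosen by [orth_proj] unique. *)
Lemma orth_projE (V : set Lgl) X Y : V Y ->
  (forall Z, V Z -> mxpair (X - Y) Z = 0) ->
  (forall Y', V Y' -> (forall Z, V Z -> mxpair (Y' - Y) Z = 0) -> Y' = Y) ->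
  orth_proj V X = Y.
Proof.
move=> VY XY uY; apply: xget_unique => [//|Y' [VY' XY']].
apply: uY => // Z VZ; have -> : Y' - Y = X - Y - (X - Y').
  by rewrite opprB [RHS]addrC addrA subrK.
by rewrite mxpairBl XY // XY' // subrr.
Qed.

Lemma mxpair_scal A (c : C) : mxpair A (c%:A : F)%:M = c * vtrace (diag_row A).
Proof.
rewrite -diag_const_mx mxpairC mxpair_diag mulr_sumr; apply: eq_bigr => i _.
by rewrite !mxE intdz_scalA.
Qed.

Lemma P00_diag x : P00 (diag_mx x) = diag_mx (scalar_row (vmean x)).
Proof.
apply: orth_projE; first by exists (vmean x); rewrite diag_const_mx.
  by move=> _ [c ->]; rewrite mxpair_scal diag_rowB !diag_rowK vtrace_mean mulr0.
move=> _ [c ->] /(_ _ (ex_intro _ 1 erefl)); rewrite mxpair_scal mul1r diag_rowB.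
rewrite -diag_const_mx !diag_rowK -/(scalar_row _) vtraceB !vtrace_cst -mulrBr => /eqP.
by rewrite mulf_eq0 (negPf nC_neq0) /= subr_eq0 => /eqP ->.
Qed.

Lemma Pdiag'_diag x : Pdiag' (diag_mx x) = diag_mx (x - scalar_row (vmean x)).
Proof. by rewrite /Pdiag' Pdiag_diag_row diag_rowK P00_diag diag_mxB. Qed.

Lemma range_Pdiag' A :
  range (@Pdiag' R m) A <-> exists2 x, vtrace x = 0 & A = diag_mx x.
Proof.
split=> [[B _ <-]|[x x0 ->]].
  exists (diag_row B - scalar_row (vmean (diag_row B))); first exact: vtrace_mean.
  by rewrite -Pdiag'_diag /Pdiag' -Pdiag_diag_row [in LHS]Pdiag_diag_row
    [in RHS]Pdiag_diag_row Pdiag_diag_row diag_rowK.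
exists (diag_mx x) => //; rewrite Pdiag'_diag /vmean x0 mulr0.
by congr diag_mx; apply/rowP => i; rewrite !mxE scale0r subr0.
Qed.

(** * The Cayley transform on diagonal matrices *)

Definition hshift x : 'rV[F]_n := \row_i h 1 (x 0 (ordS i)).

Lemma hshiftB x y : hshift (x - y) = hshift x - hshift y.
Proof. by apply/rowP => i; rewrite !mxE hpowB. Qed.
Lemma hshift_cst c : hshift (scalar_row c) = scalar_row c.
Proof. by apply/rowP => i; rewrite !mxE hpow_cst. Qed.

Lemma htau_diag x : htau q (diag_mx x) = diag_mx (hshift x).
Proof.
apply/matrixP => i j; rewrite !mxE eqxx mulr1n.
by case: eqVneq => _; rewrite ?mulr1n // !mulr0n hpow_0.
Qed.

Lemma vtrace_hshift x : vtrace (hshift x) = vtrace x.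
Proof.
rewrite /vtrace [RHS](reindex_inj (@ordS_inj n)); apply: eq_bigr => i _.
by rewrite mxE intdz_hpow.
Qed.

Lemma ordS_inord k : (k < m)%N -> ordS (inord k : 'I_n) = inord k.+1.
Proof.
by move=> km; apply: val_inj; rewrite /= !inordK ?modn_small //; lia.
Qed.
Lemma ordS_last : ordS (inord m : 'I_n) = ord0.
Proof. by apply: val_inj; rewrite /= inordK // modnn. Qed.

(** Going around the cycle once multiplies by [h^n], so every entry is a fixed
point of [h^n], hence constant, and the entries are all equal. *)
Lemma hshift_fixed x : vtrace x = 0 -> x = hshift x -> x = 0.
Proof.
move=> x0 xh; have xS i : x 0 i = h 1 (x 0 (ordS i)) by rewrite {1}xh mxE.
have xk k : (k <= m)%N -> x 0 ord0 = h k (x 0 (inord k)).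
  elim: k => [_|k IHk km].
    by rewrite hpow_id //; congr (x 0 _); apply: val_inj; rewrite /= inordK.
  by rewrite IHk 1?ltnW // xS ordS_inord // hpow_hpow // addrC -intS.
have xn : h n (x 0 ord0) = x 0 ord0.
  by rewrite [in RHS](xk m) // (xS (inord m)) ordS_last hpow_hpow // addrC -intS.
have x0c := hpow_fixed hq (ltn0Sn m) xn.
have xc : x = scalar_row (intdz (x 0 ord0)).
  apply/rowP => i; rewrite mxE -x0c -[LHS](hpowVK hq i).
  have <- : (inord i : 'I_n) = i by apply: val_inj; rewrite /= inordK.
  rewrite inordK // -xk -1?ltnS //.
  by rewrite x0c hpow_cst.
move: x0; rewrite xc vtrace_cst => /eqP; rewrite mulf_eq0 (negPf nC_neq0) /=.
by move=> /eqP ->; apply/rowP => i; rewrite !mxE scale0r.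
Qed.

(** The adjoint of the embedding of series into [Un]; see [mxpair_embU]. *)
Definition twisted_sum x : F := \sum_(i < n) h i (x 0 i).

Lemma twisted_sumB x y : twisted_sum (x - y) = twisted_sum x - twisted_sum y.
Proof. by rewrite /twisted_sum -sumrB; apply: eq_bigr => i _; rewrite !mxE hpowB. Qed.
Lemma intdz_twisted_sum x : intdz (twisted_sum x) = vtrace x.
Proof. by rewrite /twisted_sum intdz_sum; apply: eq_bigr => i _; rewrite intdz_hpow. Qed.

(** Unrolling [y_i = x_i + h y_(i+1)] around the cycle leaves one equation for
[y_0], namely [y_0 - h^n y_0 = sum_j h^j x_j], whose right-hand side has no
constant term. *)
Lemma hshift_solve x : vtrace x = 0 -> exists2 y, vtrace y = 0 & x = y - hshift y.
Proof.
move=> x0; pose s := twisted_sum x; pose k := inv1h q n s.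
have ks : k - h n k = s by rewrite inv1hK // intdz_twisted_sum.
pose y : 'rV[F]_n :=
  \row_i (\sum_(j < n | (i <= j)%N) h (j - i)%N (x 0 j) + h (n - i)%N k).
suff xy : x = y - hshift y.
  exists (y - scalar_row (vmean y)); first exact: vtrace_mean.
  by rewrite hshiftB hshift_cst opprB addrA subrK -xy.
have y0 : y 0 ord0 = k.
  rewrite mxE subn0 -[RHS](subrK (h n k)) ks; congr (_ + _).
  by apply: eq_bigr => j _; rewrite subn0.
apply/rowP => i; rewrite !mxE; have := ltn_ord i; rewrite ltnS leq_eqVlt.
case/orP => [/eqP im|im].
  have -> : ordS i = ord0 by apply: val_inj; rewrite /= im modnn.
  have := y0; rewrite mxE => ->; rewrite im subSnn addrK.
  rewrite (big_pred1 i) /= ?im ?subnn ?hpow_id // => j.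
  rewrite /pred1 /= -(inj_eq val_inj) /= im eqn_leq.
  by have := ltn_ord j; rewrite ltnS => ->.
have Si : ordS i = i.+1 :> nat by rewrite /= modn_small.
rewrite (bigD1 i) // subnn hpow_id // Si hpowDr // hpow_hpow //.
rewrite (_ : 1 + (n - i.+1)%N%:Z = (n - i)%N); last by lia.
rewrite opprD addrACA subrr addr0 hpow_sum // -addrA -[LHS]addr0; congr (_ + _).
apply/esym/eqP; rewrite subr_eq0; apply/eqP; apply: eq_big => [j|j /andP[ij ji]].
  by rewrite -(inj_eq val_inj) /= [(i < j)%N]ltn_neqAle andbC eq_sym.
rewrite hpow_hpow //; congr hpow; move: ji; rewrite -(inj_eq val_inj) /=; lia.
Qed.

Lemma inv_1_htauE x : vtrace x = 0 ->
  inv_1_htau q (diag_mx (x - hshift x)) = diag_mx x.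
Proof.
move=> x0; rewrite diag_mxB -htau_diag.
rewrite -[LHS]/('pinv_(fun=> 0) (range (@Pdiag' R m)) (fun A => A - htau q A)
  ((fun A => A - htau q A) (diag_mx x))).
rewrite pinvKV //; last by rewrite inE; apply/range_Pdiag'; exists x.
move=> A B; rewrite !inE => /range_Pdiag'[y y0 ->] /range_Pdiag'[z z0 ->].
rewrite !htau_diag -!diag_mxB => /(congr1 diag_row); rewrite !diag_rowK => yz.
suff : y - z = 0 by move/eqP; rewrite subr_eq0 => /eqP ->.
apply: hshift_fixed; first by rewrite vtraceB y0 z0 subrr.
rewrite hshiftB; apply/eqP; rewrite -subr_eq0; apply/eqP.
have -> : y - z - (hshift y - hshift z) = (y - hshift y) - (z - hshift z).
  by apply/rowP => i; rewrite !mxE; ring.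
by rewrite yz subrr.
Qed.

(** * The subspace U_n *)

Local Notation embU := (@embU R q m).

Lemma embUD f g : embU (f + g) = embU f + embU g.
Proof. by rewrite -diag_mxD; congr diag_mx; apply/rowP => i; rewrite !mxE hpowDr. Qed.
Lemma embUB f g : embU (f - g) = embU f - embU g.
Proof. by rewrite -diag_mxB; congr diag_mx; apply/rowP => i; rewrite !mxE hpowB. Qed.
Lemma embU0 : embU 0 = 0.
Proof. by rewrite -[0 in LHS](subrr 0) embUB subrr. Qed.
Lemma embU00 f : embU f ord0 ord0 = f.
Proof. by rewrite !mxE eqxx mulr1n hpow_id. Qed.
Lemma embU_inj : injective embU.
Proof. by move=> f g /(congr1 (fun A : Lgl => A ord0 ord0)); rewrite !embU00. Qed.
Lemma embUZ (c : C) f : embU (c *: f) = (c%:A : F) *: embU f.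
Proof.
rewrite -linearZ; congr diag_mx; apply/rowP => i; rewrite !mxE.
have -> : c *: f = c%:A * f by rewrite -scalerAl mul1r.
by rewrite hpowM // hpow_cst.
Qed.
Lemma embU_hpow f : embU (h 1 f) = hmx 1 (embU f).
Proof.
apply/matrixP => i j; rewrite !mxE; case: eqVneq => _; rewrite ?mulr0n ?mulr1n.
  by rewrite !hpow_hpow // addrC.
by rewrite hpow_0.
Qed.

Lemma mxpair_embU f x : mxpair (embU f) (diag_mx x) = intdz (f * twisted_sum x).
Proof.
rewrite mxpair_diag mulr_sumr intdz_sum; apply: eq_bigr => i _.
by rewrite !mxE eqxx mulr1n -(intdz_hpow q i) hpowM // hpowK.
Qed.

Lemma twisted_sum_embU f : twisted_sum (\row_(i < n) h (- i%:Z) f) = n%:R * f.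
Proof.
rewrite /twisted_sum (eq_bigr (fun=> f)); last by move=> i _; rewrite mxE hpowK.
by rewrite sumr_const card_ord mulr_natl.
Qed.

Lemma nF_neq0 : (n%:R : F) != 0.
Proof.
apply/eqP => /(congr1 (@intdz C)) /eqP.
by rewrite scalA_nat intdz_cst intdz0 (negPf nC_neq0).
Qed.

Lemma orth_proj_Un x : orth_proj (Un q (m := m)) (diag_mx x) = embU (n%:R^-1 * twisted_sum x).
Proof.
apply: orth_projE; first by eexists.
  move=> _ [g _ <-]; rewrite /Defs.embU -diag_mxB mxpairC mxpair_embU.
  rewrite twisted_sumB twisted_sum_embU.
  by rewrite mulVKf ?nF_neq0 // subrr mulr0.
move=> _ [f _ <-] fx; congr embU; apply/eqP; rewrite -subr_eq0; apply/eqP.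
apply: intdz_nondeg => g; have := fx (embU (n%:R^-1 * g)).
rewrite -embUB (mxpair_embU _ (\row_(i < n) h (- i%:Z) (n%:R^-1 * g))) twisted_sum_embU.
by rewrite mulVKf ?nF_neq0 //; apply; eexists.
Qed.

End MatrixPairing.

(** * The r-matrix and the bracket on the loop algebra *)

Section RMatrixBracket.
Variables (R : realType) (q : R[i]) (m : nat).
Hypothesis hq : 0 < `|q| < 1.
Local Notation C := R[i].
Local Notation n := m.+1.
Local Notation F := (laurent C).
Local Notation Lgl := 'M[F]_n.
Local Notation h := (hpow q).
Local Notation hmx := (@hmx R q m).
Local Notation embU := (@embU R q m).
Variable Delta : Lgl -> Lgl.
Hypothesis hDelta : skew_operator_in_Un q Delta.
Implicit Types (A B X Y L d k : Lgl) (x y a b : 'rV[F]_n) (f g : F).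

Local Notation E := (End_Un_laurent q Delta).

Lemma Un_embU f : Un q (embU f). Proof. by exists f. Qed.

Lemma Delta_embU f : Delta (embU f) = embU (E f).
Proof.
have [g _ gE] := Un_stable hDelta (Un_embU f).
by rewrite /End_Un_laurent -gE embU00.
Qed.

Lemma EndD f g : E (f + g) = E f + E g.
Proof.
apply: (@embU_inj R q m); rewrite embUD // -!Delta_embU embUD //.
have := Un_linear hDelta 1 (Un_embU f) (Un_embU g).
by rewrite !scale1r.
Qed.

Lemma End0 : E 0 = 0.
Proof. by apply: (addIr (E 0)); rewrite -EndD !add0r. Qed.

Lemma EndZ (c : C) f : E (c *: f) = c *: E f.
Proof.
apply: (@embU_inj R q m); rewrite embUZ // -!Delta_embU embUZ //.
have := Un_linear hDelta c (Un_embU f) (Un_embU 0).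
by rewrite (Delta_embU 0) End0 embU0 // !addr0.
Qed.

Lemma EndN f : E (- f) = - E f.
Proof. by apply: (addIr (E f)); rewrite -EndD !addNr End0. Qed.

Lemma EndB f g : E (f - g) = E f - E g.
Proof. by rewrite EndD EndN. Qed.

Lemma End_hpow1 f : E (h 1 f) = h 1 (E f).
Proof.
apply: (@embU_inj R q m); rewrite embU_hpow // -!Delta_embU embU_hpow //.
exact: (Un_commute hDelta (Un_embU f)).
Qed.

Lemma End_hpow i f : E (h i f) = h i (E f).
Proof.
have pos (j : nat) g : E (h j g) = h j (E g).
  elim: j g => [|j IHj] g; first by rewrite !hpow_id.
  by rewrite intS -!hpow_hpow // End_hpow1 IHj.
case: i => j; first exact: pos.
rewrite NegzE; have := pos j.+1 (h (- j.+1%:Z) f).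
by rewrite hpowK // => ->; rewrite hpowVK.
Qed.

(** The inverse of [1 - h tau] enters through a preimage [x], and the scalar
[c] is the component killed by the projection.  The factor [n] in front of
[Delta] compensates for the [1/n] in the projection onto [Un]. *)
Lemma rhat0E a x c : vtrace x = 0 -> a = x - hshift q x + scalar_row m c ->
  rhat0 q Delta (diag_mx a) =
  (2^-1 : F) *: diag_mx (x + hshift q x) + embU (E (twisted_sum q a)).
Proof.
move=> x0 ax; rewrite /rhat0 Pdiag'_diag //.
have ac : vmean a = c.
  rewrite /vmean ax vtraceD vtraceB // vtrace_hshift // x0 subrr add0r vtrace_cst mulKf //.
rewrite ac {1 2}ax addrK inv_1_htauE // htau_diag // -diag_mxD; congr (_ + _).
have uE : twisted_sum q a = (n%:R : C) *: ((n%:R : F)^-1 * twisted_sum q a).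
  by rewrite scaler_nat -(mulr_natl (_ * _)) mulVKf // nF_neq0.
by rewrite orth_proj_Un // Delta_embU [in RHS]uE EndZ embUZ // -scalA_nat.
Qed.

Lemma rhat0_ex a : exists x c, vtrace x = 0 /\ a = x - hshift q x + scalar_row m c.
Proof.
have [x x0 ax] := hshift_solve hq (vtrace_mean a).
by exists x, (vmean a); split; rewrite // -ax subrK.
Qed.

Lemma rhat0B a b :
  rhat0 q Delta (diag_mx (a - b)) =
  rhat0 q Delta (diag_mx a) - rhat0 q Delta (diag_mx b).
Proof.
have [x [c [x0 ax]]] := rhat0_ex a; have [y [e [y0 byE]]] := rhat0_ex b.
rewrite (rhat0E x0 ax) (rhat0E y0 byE) (@rhat0E _ (x - y) (c - e)).
- rewrite hshiftB // twisted_sumB // EndB embUB //.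
  rewrite (_ : x - y + _ = (x + hshift q x) - (y + hshift q y)).
    by rewrite diag_mxB scalerBr opprD addrACA.
  by rewrite opprD addrACA.
- by rewrite vtraceB x0 y0 subrr.
- rewrite ax byE hshiftB //; apply/rowP => i; rewrite !mxE scalerBl; ring.
Qed.

Definition dilate_row i x : 'rV[F]_n := \row_j h i (x 0 j).

Lemma hmx_diag i x : hmx i (diag_mx x) = diag_mx (dilate_row i x).
Proof.
apply/matrixP => j k; rewrite !mxE; case: eqVneq => _; rewrite ?mulr0n ?mulr1n //.
by rewrite hpow_0.
Qed.

Lemma rhat0_hmx i a :
  rhat0 q Delta (hmx i (diag_mx a)) = hmx i (rhat0 q Delta (diag_mx a)).
Proof.
have [x [c [x0 ax]]] := rhat0_ex a.
rewrite hmx_diag (rhat0E x0 ax) (@rhat0E _ (dilate_row i x) c).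
- rewrite hmxD // hmxVZ // hmx_diag; congr (_ *: diag_mx _ + _).
    by apply/rowP => j; rewrite !mxE hpowDr // !hpow_hpow // [(i + 1)%R]addrC.
  rewrite (_ : twisted_sum q _ = h i (twisted_sum q a)).
    rewrite End_hpow; apply/matrixP => j k; rewrite !mxE.
    case: eqVneq => _; rewrite ?mulr0n ?mulr1n ?hpow_0 //.
    by rewrite !hpow_hpow // addrC.
  rewrite /twisted_sum hpow_sum //; apply: eq_bigr => j _.
  by rewrite mxE !hpow_hpow // addrC.
- by rewrite -[RHS]x0; apply: eq_bigr => j _; rewrite mxE intdz_hpow.
- apply/rowP => j; rewrite ax !mxE hpowDr // hpowB // hpow_cst // !hpow_hpow //.
  by rewrite [(i + 1)%R]addrC.
Qed.

Local Notation rhat := (rhat q Delta).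

Lemma rhatB A B : rhat (A - B) = rhat A - rhat B.
Proof.
rewrite /Defs.rhat !Pdiag_diag_row diag_rowB rhat0B.
have -> : Pplus (A - B) - Pminus (A - B) = (Pplus A - Pminus A) - (Pplus B - Pminus B).
  by apply/matrixP => i j; rewrite !mxE; case: ifP => _; case: ifP => _; ring.
have ACA (V : zmodType) (u v x y : V) : u - v + (x - y) = u + x - (v + y).
  by rewrite opprD addrACA.
by rewrite scalerBr ACA.
Qed.

Lemma rhat_hmx i A : rhat (hmx i A) = hmx i (rhat A).
Proof.
have diag_row_hmx : diag_row (hmx i A) = dilate_row i (diag_row A).
  by apply/rowP => j; rewrite !mxE.
rewrite /Defs.rhat hmxD // hmxVZ // !Pdiag_diag_row -rhat0_hmx hmx_diag diag_row_hmx.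
congr (_ *: _ + _); apply/matrixP => j k; rewrite !mxE.
by rewrite hpowB //; congr (_ - _); case: ifP => _ //; rewrite hpow_0.
Qed.

(** Transporting the left gradient by [h^-1] makes the two gradients transform
in the same way under gauge transformations. *)
Definition left_grad L d : Lgl := hmx (-1) (L *m d).
Definition right_grad L d : Lgl := d *m L.
Definition gap_grad L d : Lgl := left_grad L d - right_grad L d.

(** The bracket as a bilinear form in two arbitrary matrices in place of the
gradients. *)
Definition loop_form L d k : C :=
  mxpair (rhat (gap_grad L d)) (gap_grad L k) +
  2^-1 * (mxpair (left_grad L d) (right_grad L k) - mxpair (right_grad L d) (left_grad L k)).

(** With [A = h^-1 (L d)] the dilations disappear from the four entries of the
bracket, because they commute with the r-matrix and preserve the pairing; the
identity parts of [rhat_plus] and [rhat_minus] give the second summand of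
[loop_form]. *)
Lemma mxbracketE phi psi L :
  mxbracket q Delta phi psi L = loop_form L (mxgrad phi L) (mxgrad psi L).
Proof.
rewrite /mxbracket /loop_form /pair2 /opmx2 /mxDgrad /= /gap_grad /left_grad.
set d := mxgrad phi L; set k := mxgrad psi L.
set A := hmx (-1) (L *m d); set B := hmx (-1) (L *m k).
have -> : L *m d = hmx 1 A by rewrite hmxK.
have -> : L *m k = hmx 1 B by rewrite hmxK.
rewrite rhat_hmx -hmxN // -hmxD // mxpair_hmx // rhatB /rhat_plus /rhat_minus.
move: (rhat A) (rhat (right_grad L d)) => rA rA'; rewrite -/(right_grad L d) -/(right_grad L k).
move: (right_grad L d) (right_grad L k) A B => A' B' A B.
rewrite (mxpairDl rA) mxpairNl (mxpairDl rA') (mxpairVl 2).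
rewrite (mxpairDl (rA - _)) (mxpairDl rA) !mxpairNl (mxpairVl 2).
rewrite mxpairBl (mxpairBr rA) (mxpairBr rA'); ring.
Qed.

End RMatrixBracket.

(** * Triangular matrices *)

Section Triangular.
Variables (F : comUnitRingType) (m : nat).
Local Notation n := m.+1.
Implicit Types (A B S : 'M[F]_n).

Definition upper A := forall i j : 'I_n, (j < i)%N -> A i j = 0.
Definition strictly_upper A := forall i j : 'I_n, (j <= i)%N -> A i j = 0.

Lemma upperD A B : upper A -> upper B -> upper (A + B).
Proof. by move=> uA uB i j ji; rewrite mxE uA // uB // addr0. Qed.
Lemma upperN A : upper A -> upper (- A).
Proof. by move=> uA i j ji; rewrite mxE uA // oppr0. Qed.

Lemma upperM A B : upper A -> upper B -> upper (A *m B).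
Proof.
move=> uA uB i j ji; rewrite mxE big1 // => k _.
by case: (ltnP k i) => ki; [rewrite uA ?mul0r|rewrite uB ?mulr0 //; apply: leq_trans ki].
Qed.

Lemma upperM_diag A B i : upper A -> upper B -> (A *m B) i i = A i i * B i i.
Proof.
move=> uA uB; rewrite mxE (bigD1 i) //= big1 ?addr0 // => k ki.
case: (ltngtP k i) => [lt|gt|/val_inj e]; first by rewrite uA ?mul0r.
  by rewrite uB ?mulr0.
by rewrite e eqxx in ki.
Qed.

Definition unipotent S := forall i j : 'I_n, (j <= i)%N -> S i j = (i == j)%:R.

Lemma unipotent_upper S : unipotent S -> upper S.
Proof.
by move=> uS i j ji; rewrite uS 1?ltnW // -(inj_eq val_inj) gtn_eqF.
Qed.

Lemma unipotent_diag S i : unipotent S -> S i i = 1.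
Proof. by move=> uS; rewrite uS // eqxx. Qed.

Lemma unipotent_unit S : unipotent S -> S \in unitmx.
Proof.
move=> uS; rewrite unitmxE -det_tr det_trig; last first.
  apply/is_trig_mxP => i j ij; rewrite mxE; exact: (unipotent_upper uS).
by rewrite big1 ?unitr1 // => i _; rewrite mxE unipotent_diag.
Qed.

(** Induction on the column [j], reading the entry [(i, j)] of [S^-1 S = 1]. *)
Lemma unipotent_inv S : unipotent S -> unipotent (invmx S).
Proof.
move=> uS i j; move: {2}(j : nat) (leqnn j) => b; elim: b j => [|b IHb] j jb ji;
  have /(congr1 (fun A : 'M[F]_n => A i j)) := mulVmx (unipotent_unit uS);
  rewrite !mxE (bigD1 j) //= unipotent_diag // mulr1 big1 ?addr0 // => k kj.
  by rewrite (unipotent_upper uS) ?mulr0 //; move: kj; rewrite -(inj_eq val_inj) /=; lia.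
case: (ltngtP k j) => [lt|gt|/val_inj e]; last by rewrite e eqxx in kj.
  rewrite IHb; [|lia|lia]; rewrite -(inj_eq val_inj) gtn_eqF ?mul0r //=.
  exact: leq_trans ji.
by rewrite (unipotent_upper uS) ?mulr0.
Qed.

End Triangular.

(** * Independence of the strictly upper triangular part of the gradients *)

Section FormInvariance.
Variables (R : realType) (q : R[i]) (m : nat).
Hypothesis hq : 0 < `|q| < 1.
Local Notation C := R[i].
Local Notation n := m.+1.
Local Notation F := (laurent C).
Local Notation Lgl := 'M[F]_n.
Local Notation h := (hpow q).
Local Notation hmx := (@hmx R q m).
Variable Delta : Lgl -> Lgl.
Hypothesis hDelta : skew_operator_in_Un q Delta.
Implicit Types (A B X Y L d k S : Lgl) (x y a b : 'rV[F]_n) (f g : F).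
Local Notation E := (End_Un_laurent q Delta).
Local Notation rhat := (rhat q Delta).
Local Notation lgrad := (left_grad q).
Local Notation dgrad := (gap_grad q).
Local Notation mxform := (loop_form q Delta).
Local Notation hshift := (hshift q).
Local Notation usum := (twisted_sum q).

Definition diagpair x y : C := \sum_i intdz (x 0 i * y 0 i).

Lemma diagpairC x y : diagpair x y = diagpair y x.
Proof. by apply: eq_bigr => i _; rewrite mulrC. Qed.
Lemma diagpairDl x y a : diagpair (x + y) a = diagpair x a + diagpair y a.
Proof. by rewrite /diagpair -big_split; apply: eq_bigr => i _; rewrite mxE mulrDl. Qed.
Lemma diagpairNl x a : diagpair (- x) a = - diagpair x a.
Proof. by rewrite /diagpair -sumrN; apply: eq_bigr => i _; rewrite mxE mulNr. Qed.
Lemma diagpairDr x y a : diagpair a (x + y) = diagpair a x + diagpair a y.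
Proof. by rewrite !(diagpairC a) diagpairDl. Qed.
Lemma diagpairNr x a : diagpair a (- x) = - diagpair a x.
Proof. by rewrite !(diagpairC a) diagpairNl. Qed.
Lemma diagpair_cst c y : diagpair (scalar_row m c) y = c * vtrace y.
Proof.
by rewrite /diagpair mulr_sumr; apply: eq_bigr => i _; rewrite mxE intdz_scalA.
Qed.
Lemma diagpair_hshift x y : diagpair (hshift x) (hshift y) = diagpair x y.
Proof.
rewrite /diagpair [RHS](reindex_inj (@ordS_inj n)); apply: eq_bigr => i _.
by rewrite !mxE -hpowM // intdz_hpow.
Qed.

Lemma mxpair_diag2 x y : mxpair (diag_mx x) (diag_mx y) = diagpair x y.
Proof.
by rewrite mxpair_diag; apply: eq_bigr => i _; rewrite mxE eqxx mulr1n.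
Qed.

Lemma mxpair_diagl x B : mxpair (diag_mx x) B = diagpair x (diag_row B).
Proof. by rewrite mxpair_diag; apply: eq_bigr => i _; rewrite mxE. Qed.

Lemma mxpair_upper A B : upper A -> upper B ->
  mxpair A B = diagpair (diag_row A) (diag_row B).
Proof.
move=> uA uB; rewrite mxpairE; apply: eq_bigr => i _.
rewrite (bigD1 i) //= !mxE big1 ?addr0 // => j ji.
case: (ltngtP j i) => [lt|gt|/val_inj e]; first by rewrite uA ?mul0r ?intdz0.
  by rewrite uB ?mulr0 ?intdz0.
by rewrite e eqxx in ji.
Qed.

(** The strictly triangular parts of the r-matrix pair an upper triangular matrix
with zero. *)
Lemma rhat_upper A B : upper A -> upper B ->
  mxpair (rhat A) B = mxpair (rhat0 q Delta (diag_mx (diag_row A))) (diag_mx (diag_row B)).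
Proof.
move=> uA uB; rewrite /Defs.rhat mxpairDl mxpairVl mxpairBl Pdiag_diag_row.
have -> : Pminus A = 0.
  by apply/matrixP => i j; rewrite !mxE; case: ifP => // /uA.
have -> : mxpair (Pplus A) B = 0.
  rewrite mxpair_upper //; first apply: big1.
    by move=> i _; rewrite !mxE ltnn mul0r.
  by move=> i j ji; rewrite mxE ltnNge ltnW.
have -> : mxpair 0 B = 0 by rewrite -(subrr B) mxpairBl subrr.
rewrite subrr mulr0 add0r.
have [x [c [x0 ax]]] := rhat0_ex hq (diag_row A).
rewrite (rhat0E hq hDelta x0 ax) !mxpairDl !mxpairVl !mxpair_diagl.
by rewrite diag_rowK.
Qed.

(** Adding a scalar matrix to [x] has no effect on either side, since [y] is
orthogonal to the identity matrix; so the mean of [x] can be subtracted. *)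
Lemma rhat0_pair x y : vtrace y = 0 ->
  mxpair (rhat0 q Delta (diag_mx (x - hshift x))) (diag_mx y) =
  2^-1 * diagpair (x + hshift x) y + intdz (E (usum (x - hshift x)) * usum y).
Proof.
move=> y0; rewrite (@rhat0E _ _ _ hq _ hDelta _ (x - scalar_row m (vmean x)) 0).
- rewrite mxpairDl mxpair_embU // mxpairVl mxpair_diag2; congr (_ * _ + _).
  by rewrite hshiftB // hshift_cst // !diagpairDl !diagpairNl !diagpair_cst y0 !mulr0 !subr0.
- exact: vtrace_mean.
- rewrite hshiftB // hshift_cst //; apply/rowP => i; rewrite !mxE scale0r; ring.
Qed.

Lemma vtrace_gap_grad L d : vtrace (diag_row (dgrad L d)) = 0.
Proof.
rewrite diag_rowB vtraceB.
have trE A : vtrace (diag_row A) = intdz (\tr A).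
  by rewrite /mxtrace intdz_sum; apply: eq_bigr => i _; rewrite mxE.
rewrite !trE /right_grad -mxtrace_mulC.
rewrite [X in X - _](_ : _ = intdz (\tr (L *m d))) ?subrr //.
rewrite /mxtrace !intdz_sum; apply: eq_bigr => i _.
by rewrite hmxE intdz_hpow.
Qed.

(** Both sides are the trace of [L d L k]. *)
Lemma left_right_grad L d k :
  mxpair (lgrad L d) (lgrad L k) = mxpair (right_grad L d) (right_grad L k).
Proof.
by rewrite mxpair_hmx // /right_grad mxpair_cyc mxpairA mulmxA.
Qed.

Lemma left_gradD L d k : lgrad L (d + k) = lgrad L d + lgrad L k.
Proof. by rewrite /left_grad mulmxDr hmxD. Qed.
Lemma right_gradD L d k : right_grad L (d + k) = right_grad L d + right_grad L k.
Proof. by rewrite /right_grad mulmxDl. Qed.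
Lemma gap_gradD L d k : dgrad L (d + k) = dgrad L d + dgrad L k.
Proof. by rewrite /gap_grad left_gradD right_gradD opprD addrACA. Qed.

Lemma rhatD A B : rhat (A + B) = rhat A + rhat B.
Proof.
have r0 : rhat 0 = 0 by rewrite -[X in rhat X](subrr 0) rhatB // subrr.
rewrite (_ : A + B = A - (0 - B)); last by rewrite sub0r opprK.
by rewrite !rhatB // r0 sub0r opprK.
Qed.

Lemma loop_formDl L d e k : mxform L (d + e) k = mxform L d k + mxform L e k.
Proof.
rewrite /loop_form gap_gradD left_gradD right_gradD rhatD.
move: (rhat (dgrad L d)) (rhat (dgrad L e)) => r1 r2.
move: (lgrad L d) (lgrad L e) (right_grad L d) (right_grad L e) => A1 A2 A1' A2'.
move: (dgrad L k) (lgrad L k) (right_grad L k) => b B B'.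
rewrite !mxpairDl; ring.
Qed.
Lemma loop_formDr L d k e : mxform L d (k + e) = mxform L d k + mxform L d e.
Proof.
rewrite /loop_form gap_gradD left_gradD right_gradD.
move: (rhat (dgrad L d)) => r; move: (dgrad L k) (dgrad L e) => b1 b2.
move: (lgrad L k) (lgrad L e) (right_grad L k) (right_grad L e) => B1 B2 B1' B2'.
move: (lgrad L d) (right_grad L d) => A A'.
rewrite !mxpairDr; ring.
Qed.

(** Only the part of [L] strictly below the diagonal matters here, and it is that
of a point of [Yn]. *)
Section Independence.
Variable L : Lgl.
Hypothesis YL : forall i j : 'I_n, (j < i)%N -> L i j = (i == j.+1 :> nat)%:R.

Lemma left_grad_strictly_upper e : strictly_upper e -> upper (lgrad L e).
Proof.
move=> ue i j ji; rewrite hmxE mxE big1 ?hpow_0 // => k _.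
case: (leqP j k) => jk; first by rewrite ue ?mulr0.
by rewrite YL ?gtn_eqF ?mul0r //; lia.
Qed.

Lemma right_grad_strictly_upper e : strictly_upper e -> upper (right_grad L e).
Proof.
move=> ue i j ji; rewrite mxE big1 // => k _.
case: (leqP k i) => ki; first by rewrite ue ?mul0r.
by rewrite YL ?gtn_eqF ?mulr0 //; lia.
Qed.

Lemma left_grad_strictly_upper0 e : strictly_upper e -> diag_row (lgrad L e) 0 ord0 = 0.
Proof.
move=> ue; rewrite mxE hmxE mxE big1 ?hpow_0 // => k _.
by rewrite ue ?mulr0.
Qed.

(** On the diagonal only the ones on the first subdiagonal of [L] contribute, so
[L e] and [e L] have the same diagonal up to a cyclic shift. *)
Lemma right_grad_hshift e : strictly_upper e ->
  diag_row (right_grad L e) = hshift (diag_row (lgrad L e)).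
Proof.
move=> ue; apply/rowP => i; rewrite mxE [RHS]mxE.
have := ltn_ord i; rewrite ltnS leq_eqVlt => /orP[/eqP im|im].
  have -> : ordS i = ord0 by apply: val_inj; rewrite /= im modnn.
  rewrite left_grad_strictly_upper0 // hpow_0 // /right_grad mxE big1 // => k _.
  by rewrite ue ?mul0r // im -ltnS ltn_ord.
have Si : ordS i = i.+1 :> nat by rewrite /= modn_small.
rewrite [in RHS]mxE hmxE hpowK // /right_grad !mxE (bigD1 (ordS i)) // YL ?Si // eqxx mulr1.
rewrite [RHS](bigD1 i) // YL ?Si // eqxx mul1r; congr (_ + _).
rewrite !big1 // => k ki.
  case: (leqP i.+1 k) => ik; first by rewrite ue ?mulr0 ?Si.
  rewrite YL ?Si // eqSS; move: ki; rewrite -(inj_eq val_inj) eq_sym => /negPf ->.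
  by rewrite mul0r.
case: (leqP k i) => ik; first by rewrite ue ?mul0r.
have /negPf kS : (k : nat) != i.+1 by rewrite -Si (inj_eq val_inj).
by rewrite YL // kS mulr0.
Qed.

(** The sum telescopes up to its two end terms, which vanish with [x_0]. *)
Lemma twisted_sum_hshift x : x 0 ord0 = 0 -> usum (hshift x) = usum x.
Proof.
move=> x0; rewrite /twisted_sum [RHS](reindex_inj (@ordS_inj n)); apply: eq_bigr => i _.
rewrite mxE hpow_hpow //; have := ltn_ord i; rewrite ltnS leq_eqVlt.
case/orP => [/eqP im|im].
  have -> : ordS i = ord0 by apply: val_inj; rewrite /= im modnn.
  by rewrite x0 !hpow_0.
by congr hpow; rewrite /= modn_small // addrC -intS.
Qed.

Lemma gap_grad_strictly_upper e : strictly_upper e -> upper (dgrad L e).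
Proof.
by move=> ue; apply: upperD (left_grad_strictly_upper ue) (upperN (right_grad_strictly_upper ue)).
Qed.

(** The r-matrix sends the diagonal [x - h tau x] of the gap of [e] to
[(x + h tau x) / 2], and its component in [Un] vanishes by [twisted_sum_hshift];
the pairing of this with the gap of [k] cancels the second
summand of the form, rewritten with [left_right_grad]. *)
Lemma loop_form_strictly_upperl e k : strictly_upper e -> upper (dgrad L k) -> mxform L e k = 0.
Proof.
move=> ue uk; have ul := left_grad_strictly_upper ue; have ur := right_grad_strictly_upper ue.
have e0 := left_grad_strictly_upper0 ue.
rewrite /loop_form rhat_upper //; last exact: gap_grad_strictly_upper.
rewrite diag_rowB right_grad_hshift // rhat0_pair ?vtrace_gap_grad //.
rewrite twisted_sumB // twisted_sum_hshift // subrr (End0 hq hDelta) mul0r intdz0 addr0.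
rewrite -right_grad_hshift // diagpairDl -!mxpair_upper // /gap_grad.
rewrite (mxpairBr (lgrad L e)) (mxpairBr (right_grad L e)) left_right_grad; ring.
Qed.

(** The mirror image of the previous lemma.  The diagonal of the gap of [d] is
written as [x - h tau x], and invariance of the pairing under [h tau] replaces
the skew-symmetry of the Cayley transform. *)
Lemma loop_form_strictly_upperr d e : strictly_upper e -> upper (dgrad L d) -> mxform L d e = 0.
Proof.
move=> ue ud; have ul := left_grad_strictly_upper ue; have ur := right_grad_strictly_upper ue.
have e0 := left_grad_strictly_upper0 ue; have ube := gap_grad_strictly_upper ue.
rewrite /loop_form rhat_upper //.
have [x [c [x0 ax]]] := rhat0_ex hq (diag_row (dgrad L d)).
have c0 : c = 0.
  have := vtrace_gap_grad L d;
  rewrite ax vtraceD vtraceB // vtrace_hshift // subrr add0r vtrace_cst.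
  by move/eqP; rewrite mulf_eq0 pnatr_eq0 => /eqP.
have {}ax : diag_row (dgrad L d) = x - hshift x.
  by rewrite ax c0; apply/rowP => i; rewrite !mxE scale0r addr0.
rewrite ax rhat0_pair; last by rewrite vtrace_gap_grad.
rewrite diag_rowB right_grad_hshift // (twisted_sumB hq (diag_row (lgrad L e))).
rewrite twisted_sum_hshift //.
rewrite subrr mulr0 intdz0 addr0.
have : mxpair (dgrad L d) (lgrad L e) + mxpair (dgrad L d) (right_grad L e) =
  mxpair (lgrad L d) (right_grad L e) - mxpair (right_grad L d) (lgrad L e).
  rewrite /gap_grad (mxpairBl _ _ (lgrad L e)) (mxpairBl _ _ (right_grad L e)) left_right_grad.
  ring.
move=> <-; rewrite !mxpair_upper // ax right_grad_hshift //.
rewrite !(diagpairDl, diagpairDr, diagpairNl, diagpairNr) !diagpair_hshift; ring.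
Qed.

Lemma loop_form_mod_strictly_upper d d' k k' :
  upper (dgrad L d) -> upper (dgrad L k) -> strictly_upper (d' - d) -> strictly_upper (k' - k) ->
  mxform L d' k' = mxform L d k.
Proof.
move=> ud uk ed ek.
have uk' : upper (dgrad L k').
  by rewrite -[k'](subrKC k) gap_gradD; apply: upperD => //; apply: gap_grad_strictly_upper.
rewrite -[d'](subrKC d) loop_formDl (loop_form_strictly_upperl ed) // addr0.
by rewrite -[k'](subrKC k) loop_formDr (loop_form_strictly_upperr ek) // addr0.
Qed.

End Independence.

(** * Gauge invariance of the form *)

Section Gauge.
Variables (S L : Lgl).
Hypothesis uS : LNplus S.

Let uSu : unipotent S. Proof. by []. Qed.
Let Sunit : S \in unitmx := unipotent_unit uSu.
Let T := invmx S.
Let uT : unipotent T := unipotent_inv uSu.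
Local Notation L' := (gauge q S L).

Let hST : hmx 1 S *m hmx 1 T = 1%:M.
Proof. by rewrite -hmxM // mulmxV // hmx1. Qed.
Let hTS : hmx 1 T *m hmx 1 S = 1%:M.
Proof. by rewrite -hmxM // mulVmx // hmx1. Qed.

Lemma gaugeK : L = hmx 1 T *m L' *m S.
Proof. by rewrite /gauge -!mulmxA mulVmx // mulmx1 mulmxA hTS mul1mx. Qed.

Lemma left_grad_gauge d : lgrad L (T *m d *m hmx 1 S) = T *m lgrad L' d *m S.
Proof.
have LE M : L = hmx 1 T *m M *m S ->
    L *m (T *m d *m hmx 1 S) = hmx 1 T *m (M *m d) *m hmx 1 S.
  by move=> ->; rewrite -!mulmxA (mulmxA S T) mulmxV // mul1mx.
rewrite /left_grad (LE _ gaugeK); move: (L' *m d) => X.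
by rewrite (hmxM hq _ (_ *m X)) (hmxM hq) !(hmxVK hq 1).
Qed.

Lemma right_grad_gauge d : right_grad L (T *m d *m hmx 1 S) = T *m right_grad L' d *m S.
Proof.
have LE M : L = hmx 1 T *m M *m S ->
    T *m d *m hmx 1 S *m L = T *m (d *m M) *m S.
  by move=> ->; rewrite -!mulmxA (mulmxA (hmx 1 S)) hST mul1mx.
by rewrite /right_grad (LE _ gaugeK).
Qed.

Lemma gap_grad_gauge d : dgrad L (T *m d *m hmx 1 S) = T *m dgrad L' d *m S.
Proof. by rewrite /gap_grad left_grad_gauge right_grad_gauge mulmxBr mulmxBl. Qed.

Lemma mxpair_conj A B : mxpair (T *m A *m S) (T *m B *m S) = mxpair A B.
Proof.
have -> : mxpair (T *m A *m S) (T *m B *m S) = mxpair (T *m A) (B *m S).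
  by rewrite mxpairA !mulmxA mulmxV // mul1mx.
by rewrite mxpair_cyc -mulmxA mulmxV // mulmx1.
Qed.

Lemma upper_conj A : upper A -> upper (T *m A *m S).
Proof.
by move=> uA; apply: upperM; first apply: upperM => //; apply: unipotent_upper.
Qed.

Lemma diag_row_conj A : upper A -> diag_row (T *m A *m S) = diag_row A.
Proof.
move=> uA; apply/rowP => i; rewrite [LHS]mxE [RHS]mxE.
have TU := unipotent_upper uT; have SU := unipotent_upper uSu.
rewrite (upperM_diag _ (upperM TU uA) SU) (upperM_diag _ TU uA).
by rewrite (unipotent_diag _ uT) (unipotent_diag _ uSu) mul1r mulr1.
Qed.

Lemma loop_form_gauge d k : upper (dgrad L' d) -> upper (dgrad L' k) ->
  mxform L (T *m d *m hmx 1 S) (T *m k *m hmx 1 S) = mxform L' d k.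
Proof.
move=> ud uk; rewrite /loop_form !left_grad_gauge !right_grad_gauge !gap_grad_gauge.
have add3 (r r' a a' b b' : C) : r = r' -> a = a' -> b = b' ->
  r + 2^-1 * (a - b) = r' + 2^-1 * (a' - b') by move=> -> -> ->.
apply: add3; [|exact: mxpair_conj|exact: mxpair_conj].
apply: etrans (rhat_upper (upper_conj ud) (upper_conj uk)) _.
apply: etrans (esym (rhat_upper ud uk)).
apply: (congr2 (fun x y => mxpair (rhat0 q Delta (diag_mx x)) (diag_mx y)));
  exact: diag_row_conj.
Qed.

End Gauge.

End FormInvariance.

(** * Derivatives along lines *)

Section Derivatives.
Variable R : realType.
Implicit Types (f g : R -> R[i]) (d : R[i]).

Lemma deriv_at0_unique f d d' : deriv_at0 f d -> deriv_at0 f d' -> d = d'.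
Proof.
case=> r1 i1 [r2 i2]; apply/eqP; rewrite eq_complex.
have := @derive_val _ _ _ _ _ _ _ r1; have := @derive_val _ _ _ _ _ _ _ i1.
by rewrite (@derive_val _ _ _ _ _ _ _ r2) (@derive_val _ _ _ _ _ _ _ i2) => -> ->;
  rewrite !eqxx.
Qed.

Lemma deriv_at0_ext f g d : (forall t, f t = g t) -> deriv_at0 f d -> deriv_at0 g d.
Proof. by move=> /funext ->. Qed.

Lemma deriv_at0_sqr f d : deriv_at0 f d -> deriv_at0 (fun t => f (t ^+ 2)) 0.
Proof.
have sq : is_derive (0 : R) 1 (fun t : R => t ^+ 2) 0.
  by apply: is_derive_eq; rewrite !scale0r addr0.
have comp (k : R -> R) (e : R) :
    is_derive (0 : R) 1 k e -> is_derive (0 : R) 1 (fun t => k (t ^+ 2)) 0.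
  move=> ke; have ke' : is_derive ((0 : R) ^+ 2) 1 k e by rewrite expr0n.
  have := @is_derive1_comp R k (fun t : R => t ^+ 2) 0 e 0 ke' sq.
  by rewrite mulr0.
by case=> r i; split; [exact: comp r|exact: comp i].
Qed.

End Derivatives.

(** * Gradients of invariant functionals *)

Section Gradients.
Variables (R : realType) (q : R[i]) (m : nat).
Hypothesis hq : 0 < `|q| < 1.
Local Notation C := R[i].
Local Notation n := m.+1.
Local Notation F := (laurent C).
Local Notation Lgl := 'M[F]_n.
Local Notation h := (hpow q).
Local Notation hmx := (@hmx R q m).
Implicit Types (A B X Y L d k S N : Lgl) (f g : F) (phi : Lgl -> C).
Local Notation dgrad := (gap_grad q).

Lemma mxgradP phi L : smooth_mx phi -> is_mxgrad phi L (mxgrad phi L).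
Proof. by move=> sphi; apply: xgetPex; apply: sphi. Qed.

(** The linear part of the gauge action of [1 - N] cancels the displacement, and
[N^2 = 0] kills the higher terms. *)
Lemma gauge_shear N L : N *m N = 0 -> 1%:M - N \in unitmx ->
  gauge q (1%:M - N) (L + (hmx 1 N *m L - L *m N)) = L + hmx 1 N *m L *m N.
Proof.
move=> NN uN; rewrite /gauge.
set P := hmx 1 N; have PP : P *m P = 0.
  by rewrite -hmxM // NN; apply/matrixP => i j; rewrite !mxE hpow_0.
have -> : hmx 1 (1%:M - N) = 1%:M - P by rewrite hmxB // hmx1.
suff -> : (1%:M - P) *m (L + (P *m L - L *m N)) = (L + P *m L *m N) *m (1%:M - N).
  by rewrite -mulmxA mulmxV // mulmx1.
rewrite mulmxBl mul1mx mulmxDr mulmxBr !mulmxA PP mul0mx sub0r.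
rewrite mulmxBr mulmx1 (mulmxDl L) -(mulmxA (P *m L) N N) NN mulmx0 addr0.
move: (P *m L) => a; move: (L *m N) (a *m N) => b c.
by apply/matrixP => i j; rewrite !mxE; ring.
Qed.

Lemma hmx_cstZ (c : C) A : hmx 1 ((c%:A : F) *: A) = (c%:A : F) *: hmx 1 A.
Proof. by rewrite hmxZ // hpow_cst. Qed.

Lemma delta_strict (i j : 'I_n) f : (i < j)%N ->
  unipotent (1%:M - f *: delta_mx i j : Lgl).
Proof.
move=> ij k l lk; rewrite !mxE (_ : (k == i) && (l == j) = false) ?mulr0 ?subr0 //.
by apply/negP => /andP[/eqP ki /eqP lj]; move: lk; rewrite ki lj leqNgt ij.
Qed.

Lemma delta_sqr0 (i j : 'I_n) f g : i != j -> (f *: delta_mx i j) *m (g *: delta_mx i j : Lgl) = 0.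
Proof.
by move=> ij; rewrite -scalemxAl -scalemxAr mul_delta_mx_0 ?scaler0 // eq_sym.
Qed.

(** For [N = f E_ij] with [i < j], the functional along the line with direction
[h N L - L N] equals the functional along the line with direction [h N L N],
taken at the square of the parameter; its derivative is therefore zero.  That
derivative is the pairing of [N] with the gap of the gradient. *)
Lemma gap_grad_upper phi L : smooth_mx phi -> LNplus_invariant q phi ->
  upper (dgrad L (mxgrad phi L)).
Proof.
move=> sphi iphi j i ij; have dP := mxgradP L sphi; set d := mxgrad phi L in dP *.
apply: intdz_nondeg => f; rewrite -mxpair_deltar.
set N : Lgl := f *: delta_mx i j.
have ij' : i != j by rewrite -(inj_eq val_inj) ltn_eqF.
have -> : mxpair (dgrad L d) N = mxpair d (hmx 1 N *m L - L *m N).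
  rewrite mxpairBl mxpairBr; congr (_ - _).
    by rewrite -[N](hmxVK hq 1) mxpair_hmx // hmxVK // mxpair_cyc mxpairC.
  by rewrite mxpairA.
apply: (deriv_at0_unique (dP _)).
pose Y := hmx 1 N *m L *m N.
apply: (deriv_at0_ext _ (deriv_at0_sqr (dP Y))) => t.
pose c : C := t%:C%C; pose N' : Lgl := (c%:A : F) *: N.
have N'E : N' = (c%:A * f) *: delta_mx i j by rewrite /N' scalerA.
have uN' : unipotent (1%:M - N') by rewrite N'E; apply: delta_strict.
rewrite -(iphi (1%:M - N') (L + (c%:A : F) *: (hmx 1 N *m L - L *m N))) //.
rewrite (_ : (c%:A : F) *: (hmx 1 N *m L - L *m N) = hmx 1 N' *m L - L *m N').
  rewrite gauge_shear; last exact: unipotent_unit.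
    have cc : ((t ^+ 2)%:C%C%:A : F) = c%:A * c%:A.
      by rewrite -[RHS]scalerAl mul1r scalerA -expr2 /c rmorphXn.
    by rewrite /N' hmx_cstZ // -!scalemxAl -scalemxAr scalerA -cc.
  by rewrite N'E delta_sqr0.
by rewrite /N' hmx_cstZ // -!scalemxAl -!scalemxAr -scalerBr.
Qed.

(** Gauge transformations are linear in [L], so they map lines to lines and
gradients are transported exactly. *)
Lemma mxgrad_gauge phi S L : smooth_mx phi -> LNplus_invariant q phi -> LNplus S ->
  mxgrad phi L = invmx S *m mxgrad phi (gauge q S L) *m hmx 1 S.
Proof.
move=> sphi iphi uS; have uS' : unipotent S by [].
apply/eqP; rewrite -subr_eq0; apply/eqP; apply: mxpair_nondeg => X.
rewrite mxpairBl; apply/eqP; rewrite subr_eq0; apply/eqP.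
apply: (deriv_at0_unique (mxgradP L sphi X)).
have -> : mxpair (invmx S *m mxgrad phi (gauge q S L) *m hmx 1 S) X =
    mxpair (mxgrad phi (gauge q S L)) (hmx 1 S *m X *m invmx S).
  by rewrite -mulmxA mxpair_cyc mxpairA mulmxA.
apply: (deriv_at0_ext _ (mxgradP _ sphi _)) => t.
rewrite -(iphi S (L + _)) //; congr phi.
by rewrite /gauge mulmxDr mulmxDl -scalemxAr -scalemxAl.
Qed.

(** * The cross-section of companion matrices *)

Local Notation companion := (@companion R m).

Lemma companion_sub (u : 'I_n -> F) (i j : 'I_n) : (j < i)%N ->
  companion u i j = (i == j.+1 :> nat)%:R.
Proof. by move=> ji; rewrite mxE -(inj_eq val_inj) /= gtn_eqF //; lia. Qed.

Lemma Yn_sub L : Yn L -> forall i j : 'I_n, (j < i)%N -> L i j = (i == j.+1 :> nat)%:R.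
Proof. by move=> [A [uA ->]] i j ji; rewrite !mxE uA // addr0. Qed.

Lemma Yn_companion u : Yn (companion u).
Proof.
exists (companion u - Lambda R m); split; last by rewrite subrKC.
by move=> i j ji; rewrite mxE companion_sub // !mxE subrr.
Qed.

Definition dilate_mul_iter L (r : nat) (v : 'rV[F]_n) : 'rV[F]_n :=
  iter r (fun v => map_mx (h 1) v *m L) v.
Definition last_unit_row : 'rV[F]_n := delta_mx 0 ord_max.

Lemma companion_mul_row u (S : Lgl) (i i' : 'I_n) :
  i = i'.+1 :> nat -> row i (companion u *m S) = row i' S.
Proof.
move=> ii; apply/rowP => j; rewrite !mxE (bigD1 i') //= big1 ?addr0.
  by rewrite mxE -(inj_eq val_inj) /= ii eqxx mul1r.
move=> k ki; rewrite mxE -(inj_eq val_inj) /= ii.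
have -> : (i'.+1 == k.+1) = false.
  by move: ki; rewrite -(inj_eq val_inj) /= eqSS eq_sym => /negPf.
by rewrite mul0r.
Qed.

Lemma row_hmxM (S L : Lgl) (i : 'I_n) : row i (hmx 1 S *m L) = map_mx (h 1) (row i S) *m L.
Proof. by rewrite row_mul map_row. Qed.

(** The equation [h S L = companion u S] gives row [i - 1] of [S] as [h] of row
[i], times [L]; and the last row of a unipotent matrix is known. *)
Lemma gauge_companion_rows S L u : LNplus S -> hmx 1 S *m L = companion u *m S ->
  forall i : 'I_n, row i S = dilate_mul_iter L (m - i) last_unit_row.
Proof.
move=> uS SL i; move: {2}(m - i)%N (erefl (m - i)%N) => k; elim: k i => [|k IHk] i ik.
  rewrite ik (_ : i = ord_max); last first.
    by apply: val_inj; have := ltn_ord i; rewrite /=; lia.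
  apply/rowP => j; rewrite !mxE eqxx /= uS; last by rewrite -ltnS.
  by rewrite eq_sym.
have im : (i < m)%N by lia.
have iS : (i.+1 < n)%N by [].
rewrite -(@companion_mul_row u S (Ordinal iS) i) // -SL row_hmxM.
by rewrite IHk /=; [rewrite ik subnS ik|lia].
Qed.

Lemma companion_gauge_inj S u u' : LNplus S ->
  gauge q S (companion u) = companion u' -> companion u = companion u'.
Proof.
move=> uS Su; have uSu : unipotent S by [].
have SE : hmx 1 S *m companion u = companion u' *m S.
  by rewrite -Su /gauge -(mulmxA _ (invmx S)) (mulVmx (unipotent_unit uSu)) mulmx1.
have u1 : LNplus (1%:M : Lgl) by move=> i j _; rewrite mxE.
have E1 : hmx 1 1%:M *m companion u = companion u *m 1%:M.
  by rewrite hmx1 // mul1mx mulmx1.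
have S1 : S = 1%:M.
  apply/row_matrixP => i; rewrite (gauge_companion_rows uS SE).
  by rewrite (gauge_companion_rows u1 E1).
by move: SE; rewrite S1 hmx1 // mul1mx mulmx1.
Qed.

(** The rows prescribed by the recursion form a unipotent matrix because [L] has
ones on the first subdiagonal; the first row of [h S L] then defines [u]. *)
Lemma gauge_companion_ex L : Yn L ->
  exists S u, LNplus S /\ gauge q S L = companion u.
Proof.
move=> /Yn_sub YL.
pose S : Lgl := \matrix_(i < n) dilate_mul_iter L (m - i) last_unit_row.
have rowS (k : nat) : (k <= m)%N -> forall j : 'I_n, (j <= m - k)%N ->
    dilate_mul_iter L k last_unit_row 0 j = (j == (m - k)%N :> nat)%:R.
  elim: k => [_ j|k IHk km j jk].
    by rewrite subn0 => jm; rewrite mxE eqxx -(inj_eq val_inj).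
  rewrite [dilate_mul_iter _ _ _]/(_ *m L) -/(dilate_mul_iter L k last_unit_row) mxE.
  have mk : (m - k < n)%N by lia.
  rewrite (bigD1 (Ordinal mk)) //= big1 ?addr0.
    rewrite mxE IHk; [|exact: ltnW|by []].
    rewrite eqxx hpow_1 // mul1r YL /=; last by lia.
    by congr (_%:R); congr nat_of_bool; apply/eqP/eqP; lia.
  move=> l lk; rewrite mxE; case: (ltngtP l (m - k)%N) => [lt|gt|e].
  - by rewrite IHk 1?ltnW // ltn_eqF // hpow_0 // mul0r.
  - by rewrite YL ?gtn_eqF ?mulr0 //; lia.
  - by move: lk; rewrite -(inj_eq val_inj) /= e eqxx.
have uS : LNplus S.
  move=> i j ji; rewrite mxE; have im := ltn_ord i.
  rewrite rowS ?leq_subr //; last by lia.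
  by rewrite subKn 1?eq_sym // -ltnS.
have uSu : unipotent S by [].
pose v := row ord0 (hmx 1 S *m L) *m invmx S.
exists S, (fun j => - v 0 j); split=> //.
suff SE : hmx 1 S *m L = companion (fun j => - v 0 j) *m S.
  by rewrite /gauge SE -mulmxA mulmxV ?mulmx1 //; apply: unipotent_unit.
apply/row_matrixP => i; have [->|i0] := eqVneq i ord0.
  rewrite [RHS]row_mul (_ : row ord0 (companion _) = v).
    by rewrite /v -mulmxA mulVmx ?mulmx1 //; apply: unipotent_unit.
  by apply/rowP => j; rewrite !mxE eqxx opprK.
have i0' : (0 < i)%N by rewrite lt0n.
have im := ltn_ord i.
have i1 : (i.-1 < n)%N by lia.
rewrite (@companion_mul_row _ S i (Ordinal i1)) /=; last by rewrite prednK.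
rewrite row_hmxM !rowK /= (_ : (m - i.-1 = (m - i).+1)%N) //; lia.
Qed.

Lemma Lop_companion_inj u u' : companion u = companion u' -> Lop hq u = Lop hq u'.
Proof.
move=> uu; rewrite /Lop; congr (_ + _); apply: eq_bigr => j _; congr (_ *: _).
have := congr1 (fun A : Lgl => A ord0 j) uu.
by rewrite !mxE eqxx => /oppr_inj.
Qed.

Lemma rho_companion u : rho hq (companion u) = Lop hq u.
Proof.
apply: xget_unique.
  exists 1%:M, u; split=> //; first by move=> i j _; rewrite mxE.
  by rewrite /gauge hmx1 // mul1mx invmx1 mulmx1.
move=> M [S [u' [uS /(companion_gauge_inj uS)/Lop_companion_inj uu ->]]].
by rewrite uu.
Qed.

Lemma rho_ex L : Yn L ->
  exists S u, [/\ LNplus S, gauge q S L = companion u & rho hq L = Lop hq u].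
Proof.
move=> /gauge_companion_ex[S [u [uS Su]]].
have ex : exists M, [set M | exists S u,
  [/\ LNplus S, gauge q S L = companion u & M = Lop hq u]] M.
  by exists (Lop hq u), S, u.
by have [S' [u' [uS' Su' rE]]] := xgetPex 0 ex; exists S', u'.
Qed.

Lemma psigradP (phi : PsiD hq -> C) M : smooth_Mn m phi -> Mn m M ->
  is_psigrad m phi M (psigrad m phi M).
Proof. by move=> sphi /sphi; apply: xgetPex. Qed.

(** Moving the first row of a companion matrix along a line moves the
coefficients of the corresponding operator along a line. *)
Lemma mxgrad_col0 (phih : Lgl -> C) (phi : PsiD hq -> C) (u : 'I_n -> F) (d : Lgl) (g : PsiD hq) :
  (forall L, Yn L -> phih L = phi (rho hq L)) ->
  is_mxgrad phih (companion u) d -> is_psigrad m phi (Lop hq u) g ->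
  forall j : 'I_n, d j ord0 = - h (m - j)%N (g (- (m - j)%N%:Z)).
Proof.
move=> phE dP [_ gP] j; apply/eqP; rewrite -subr_eq0 opprK; apply/eqP.
apply: intdz_nondeg => b; rewrite mulrDl intdzD.
pose X : Lgl := (- b) *: delta_mx ord0 j.
(* The coefficient [u j] belongs to [D^(m - j)], whence the reversed index. *)
pose x (i : 'I_n) : F := if i == rev_ord j then b else 0.
have dX := dP X; have gX := gP x.
rewrite mxpair_deltar in dX.
have xE : \sum_(i < n) x i *: Dp hq i = b *: Dp hq (m - j)%N.
  rewrite (bigD1 (rev_ord j)) //= big1 ?addr0 /x ?eqxx //=.
  by move=> i /negPf ->; rewrite scale0r.
have eqt t : phi (Lop hq u + (t%:C%C%:A : F) *: (\sum_(i < n) x i *: Dp hq i)) =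
    phih (companion u + (t%:C%C%:A : F) *: X).
  pose u' i := u i + (if i == j then t%:C%C%:A * b else 0).
  have -> : companion u + (t%:C%C%:A : F) *: X = companion u'.
    apply/matrixP => k l; rewrite !mxE /u'; case: (eqVneq k ord0) => k0 /=.
      by case: (eqVneq l j) => _; rewrite ?mulr1 ?mulr0 ?addr0 // opprD mulrN.
    by rewrite !mulr0 addr0.
  rewrite phE; last exact: Yn_companion.
  rewrite rho_companion xE scalerA /Lop -addrA; congr (phi (_ + _)).
  under [RHS]eq_bigr => i _ do rewrite /u' scalerDl.
  rewrite big_split /=; congr (_ + _); rewrite (bigD1 j) //= eqxx subSS.
  by rewrite big1 ?addr0 // => i /negPf ->; rewrite scale0r.
have := deriv_at0_unique dX (deriv_at0_ext eqt gX).
rewrite xE mulrN intdzN => /eqP; rewrite eq_sym -subr_eq0 opprK => /eqP gd.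
rewrite addrC -[RHS]gd; congr (_ + _); rewrite /psipair /psiTr /psi0.
by rewrite -scalerAl slcoefZ slcoef_monoM sub0r mulrC.
Qed.

End Gradients.

(** * Traces of q-pseudodifference operators *)

Section Operators.
Variables (R : realType) (q : R[i]) (m : nat).
Hypothesis hq : 0 < `|q| < 1.
Local Notation C := R[i].
Local Notation n := m.+1.
Local Notation F := (laurent C).
Local Notation Psi := (PsiD hq).
Local Notation h := (hpow q).
Local Notation Dp := (Dp hq).
Implicit Types (A B X Y g k : Psi) (v w : 'rV[F]_n) (f : F) (u : 'I_n -> F).

Lemma DpM i j : Dp i * Dp j = Dp (i + j). Proof. exact: slmonoM. Qed.
Lemma Dp0 : Dp 0 = 1. Proof. by []. Qed.
Lemma DpZM i f A : Dp i * (f *: A) = h i f *: (Dp i * A).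
Proof. exact: slmonoZM. Qed.
Lemma coefDpM i A j : slcoef (Dp i * A) j = h i (slcoef A (j - i)).
Proof. exact: slcoef_monoM. Qed.
Lemma coefDp i j : slcoef (Dp i) j = (j == i)%:R. Proof. by []. Qed.

Lemma psiTr_mulC A B : psiTr (A * B) = psiTr (B * A).
Proof.
have [N AN] := slaurent_bounded A; have [M BM] := slaurent_bounded B.
have [AB0 ABE] := slmul_spec AN BM; have [BA0 BAE] := slmul_spec BM AN.
rewrite /psiTr /psi0; case: (ltP (N + M) 0) => [lt|le].
  by rewrite [slcoef (A * B) 0]AB0 // [slcoef (B * A) 0]BA0 // addrC.
have [p pE] : exists p : nat, N + M = p by exists `|(N + M)%R|%N; lia.
have ABp := ABE p; have BAp := BAE p.
rewrite [M + N]addrC pE subrr in BAp; rewrite pE subrr in ABp.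
have -> : slcoef (A * B) 0 = _ := ABp; have -> : slcoef (B * A) 0 = _ := BAp.
rewrite !intdz_sum.
rewrite (reindex_inj rev_ord_inj); apply: eq_bigr => i _ /=.
have ip := ltn_ord i; rewrite subSS subKn; last by rewrite -ltnS.
have -> : N - (p - i)%N%:Z = - (M - i%:Z) by lia.
have swap (a b : F) e : intdz (a * h (- e) b) = intdz (b * h e a).
  by rewrite -[LHS](intdz_hpow q e) hpowM // hpowK // mulrC.
exact: swap.
Qed.

Lemma psipairC A B : psipair A B = psipair B A.
Proof. exact: psiTr_mulC. Qed.
Lemma psipairA A B X : psipair (A * B) X = psipair A (B * X).
Proof. by rewrite /psipair mulrA. Qed.
Lemma psipair_cyc A B X : psipair (A * B) X = psipair B (X * A).
Proof. by rewrite psipairC -psipairA psipairC. Qed.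
Lemma psipairDl A B X : psipair (A + B) X = psipair A X + psipair B X.
Proof. by rewrite /psipair mulrDl. Qed.
Lemma psipairNl A X : psipair (- A) X = - psipair A X.
Proof. by rewrite /psipair mulNr. Qed.
Lemma psipairBl A B X : psipair (A - B) X = psipair A X - psipair B X.
Proof. by rewrite psipairDl psipairNl. Qed.
Lemma psipairZl f A X : psipair (f *: A) X = intdz (f * slcoef (A * X) 0).
Proof. by rewrite /psipair -scalerAl. Qed.
Lemma psipair_scal f X : psipair (f%:A) X = intdz (f * slcoef X 0).
Proof. by rewrite psipairZl mul1r. Qed.
Lemma psipair_pos A B : psipair (psipos A) B = psipair A (psineg B).
Proof.
rewrite /psipair /psiTr /psi0 !slcoefM; congr intdz.
apply: eq_fsbigr => i _; rewrite /= sub0r oppr_lt0.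
by case: ifP => _; rewrite ?mul0r ?hpow_0 ?mulr0.
Qed.

Lemma psipos_coef A i : slcoef (psipos A) i = if 0 < i then slcoef A i else 0.
Proof. by []. Qed.

(** * Companion matrices and division with remainder *)

(** Degrees run from [1] to [n]: with this normalization the last row of the
normalized gradient becomes a strictly positive part, see [row_op_rr0]. *)
Definition row_op v : Psi := \sum_(j < n) v 0 j *: Dp (n - j)%N.

Lemma row_op_coef v (j : 'I_n) : slcoef (row_op v) (n - j)%N = v 0 j.
Proof.
rewrite slcoef_sum (bigD1 j) //= eqxx mulr1 big1 ?addr0 // => i ij.
rewrite (_ : _ == _ = false) ?mulr0 //.
apply/negbTE; apply: contra ij => /eqP; have := ltn_ord i; have := ltn_ord j.
by move=> jn iN e; apply/eqP/val_inj => /=; lia.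
Qed.

Lemma row_op_supp v i : ~~ (0 < i <= n%:Z) -> slcoef (row_op v) i = 0.
Proof.
move=> iN; rewrite slcoef_sum big1 // => j _ /=.
rewrite (_ : _ == _ = false) ?mulr0 //.
by apply/negbTE; apply: contra iN => /eqP ->; have := ltn_ord j; lia.
Qed.

Lemma row_opD v w : row_op (v + w) = row_op v + row_op w.
Proof. by rewrite /row_op -big_split; apply: eq_bigr => j _; rewrite mxE scalerDl. Qed.
Lemma row_opZ f v : row_op (f *: v) = f *: row_op v.
Proof. by rewrite /row_op scaler_sumr; apply: eq_bigr => j _; rewrite mxE scalerA. Qed.
Lemma row_opN v : row_op (- v) = - row_op v.
Proof. by rewrite -scaleN1r row_opZ scaleN1r. Qed.
Lemma row_op_sum (r : seq 'I_n) (G : 'I_n -> 'rV[F]_n) :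
  row_op (\sum_(i <- r) G i) = \sum_(i <- r) row_op (G i).
Proof.
elim/big_rec2: _ => [|i a b _ <-]; last by rewrite row_opD.
by rewrite -(scale0r 0) row_opZ scale0r.
Qed.

(** The coefficients of the operator are paired with those of [k] in degrees [-n]
to [-1]. *)
Lemma row_op_pair v k :
  psipair (row_op v) k = \sum_(j < n) intdz (v 0 j * h (n - j)%N (slcoef k (- (n - j)%N%:Z))).
Proof.
rewrite /psipair /psiTr /psi0 /row_op mulr_suml slcoef_sum intdz_sum.
apply: eq_bigr => j _; rewrite -scalerAl slcoefZ.
by rewrite [X in _ * X]coefDpM sub0r.
Qed.

Section FixedOperator.
Variable u : 'I_n -> F.
Local Notation L := (Lop hq u).
Local Notation Cu := (companion u).

Lemma Lop_coefn : slcoef L n = 1.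
Proof.
rewrite slcoefD slcoef_sum /= eqxx big1 ?addr0 // => j _.
by rewrite (_ : _ == _ = false) ?mulr0 //; apply/negbTE; lia.
Qed.

Lemma Lop_coef (j : 'I_n) : slcoef L (n - j.+1)%N = u j.
Proof.
rewrite slcoefD slcoef_sum (bigD1 j) //= eqxx mulr1 big1 ?addr0.
  by rewrite (_ : _ == _ = false) ?add0r //; apply/negbTE; lia.
move=> i ij; rewrite (_ : _ == _ = false) ?mulr0 //.
apply/negbTE; apply: contra ij => /eqP; have := ltn_ord i; have := ltn_ord j.
by move=> jn iN e; apply/eqP/val_inj => /=; lia.
Qed.

Lemma Lop_supp i : ~~ (0 <= i <= n%:Z) -> slcoef L i = 0.
Proof.
move=> iN; rewrite slcoefD slcoef_sum /= (_ : _ == _ = false) ?add0r; last first.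
  by apply/negbTE; lia.
rewrite big1 // => j _; rewrite (_ : _ == _ = false) ?mulr0 //.
by apply/negbTE; lia.
Qed.

Lemma row_companion v (j : 'I_n) :
  (v *m Cu) 0 j = slcoef (row_op v) (n - j.+1)%N - v 0 ord0 * u j.
Proof.
rewrite mxE (bigD1 ord0) //= mxE eqxx mulrN addrC; congr (_ - _).
have := ltn_ord j; rewrite ltnS leq_eqVlt => /orP[/eqP jm|jm].
  rewrite jm subnn row_op_supp // big1 // => i i0.
  by rewrite mxE (negPf i0) jm (ltn_eqF (ltn_ord i)) mulr0.
have jn : (j.+1 < n)%N by [].
have -> : slcoef (row_op v) (n - j.+1)%N = v 0 (Ordinal jn) := row_op_coef v (Ordinal jn).
rewrite (bigD1 (Ordinal jn)) //= big1 ?addr0 => [|i /andP[i0 ij]].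
  by rewrite mxE /= eqxx mulr1.
rewrite mxE (negPf i0) (_ : _ == _ = false) ?mulr0 //.
by apply/negbTE; move: ij; rewrite -(inj_eq val_inj).
Qed.

(** Multiplying a row by the companion matrix is multiplication by [D] modulo
    left multiples of [L]. *)
Lemma row_op_step v :
  row_op (map_mx (h 1) (v *m Cu)) = Dp 1 * (row_op v - v 0 ord0 *: L).
Proof.
apply: slaurentP => i; rewrite coefDpM slcoefB slcoefZ.
case: (boolP (0 < i <= n%:Z)) => iN.
  have jn : (`|(n%:Z - i)%R| < n)%N by lia.
  have [j ->] : exists j : 'I_n, i = (n - j)%N by exists (Ordinal jn) => /=; lia.
  have jn' := ltn_ord j.
  have -> : (n - j)%N%:Z - 1 = (n - j.+1)%N by lia.
  by rewrite row_op_coef mxE row_companion Lop_coef.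
rewrite row_op_supp //; have [->|iN1] := eqVneq i (n%:Z + 1).
  have e : slcoef (row_op v) n = v 0 ord0 := row_op_coef v ord0.
  by rewrite addrK Lop_coefn mulr1 e subrr hpow_0.
rewrite row_op_supp ?Lop_supp ?mulr0 ?subrr ?hpow_0 //; lia.
Qed.

Variable g : Psi.
Hypothesis g_supp : forall i : int, ~~ (- n%:Z < i <= 0) -> slcoef g i = 0.

Definition gtrunc (p : nat) : Psi := sltrunc (fun i : int => - p%:Z < i) g.

Lemma gtrunc0 : gtrunc 0 = 0.
Proof.
apply: slaurentP => i /=; rewrite oppr0; case: ifP => // i0.
by rewrite g_supp //; lia.
Qed.

Lemma gtruncn : gtrunc n = g.
Proof.
apply: slaurentP => i /=; case: ifP => // i0.
by rewrite g_supp //; lia.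
Qed.

Lemma gtruncS p : gtrunc p.+1 = gtrunc p + slcoef g (- p%:Z) *: Dp (- p%:Z).
Proof.
apply: slaurentP => i; rewrite slcoefD slcoefZ /=.
have [->|ip] := eqVneq i (- p%:Z).
  by rewrite ltxx mulr1 add0r ifT //; lia.
rewrite mulr0 addr0; congr (if _ then _ else _); lia.
Qed.

(** The rows of the normalized gradient, from the last one upwards. *)
Variable rr : nat -> 'rV[F]_n.
Hypothesis rrS : forall k : nat, rr k.+1 = map_mx (h 1) (rr k *m Cu).
Hypothesis rr0 : forall k : nat, (k <= m)%N -> rr k 0 ord0 = - h k (slcoef g (- k%:Z)).

Lemma row_op_rr (k : nat) : (k <= n)%N -> row_op (rr k) = Dp k * (row_op (rr 0) + gtrunc k * L).
Proof.
elim: k => [_|k IHk km]; first by rewrite gtrunc0 mul0r addr0 Dp0 mul1r.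
rewrite rrS row_op_step IHk 1?ltnW // rr0 // scaleNr opprK gtruncS intS -DpM -mulrA.
congr (_ * _); rewrite [in RHS]mulrDl addrA [RHS]mulrDr; congr (_ + _).
by rewrite mulrA DpZM DpM subrr Dp0 -scalerAl mul1r.
Qed.

(** One step beyond the last row, the operator still has degree at most [n], while
the factor [D^n] raises degrees by [n]; so the factor in parentheses in
[row_op_rr] has no positive part. *)
Lemma row_op_rr0 : row_op (rr 0) = - psipos (g * L).
Proof.
apply: slaurentP => i; rewrite slcoefN /=; case: ifP => i0; last first.
  by rewrite oppr0 row_op_supp //; lia.
apply/eqP; rewrite -addr_eq0 -[in X in _ + X]gtruncn; apply/eqP.
apply: (can_inj (hpowVK hq n)); rewrite hpow_0 //.
have := congr1 (fun X : Psi => slcoef X (i + n%:Z)) (row_op_rr (leqnn n)).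
by rewrite coefDpM addrK => <-; apply: row_op_supp; lia.
Qed.

(** The positive part of [D^p g] is [D^p] times the part of [g] of degree greater
than [-p]. *)
Lemma psipos_Lop_mul :
  psipos (L * g) = Dp n * gtrunc n + \sum_(j < n) u j *: (Dp (m - j)%N * gtrunc (m - j)).
Proof.
have tr p i : slcoef (Dp p%:Z * gtrunc p) i =
    if 0 < i then slcoef (Dp p%:Z * g) i else 0.
  rewrite !coefDpM /= (_ : (- p%:Z < i - p%:Z) = (0 < i)); last by lia.
  by case: ifP; rewrite // hpow_0.
apply: slaurentP => i; rewrite slcoefD slcoef_sum tr.
rewrite psipos_coef mulrDl mulr_suml slcoefD slcoef_sum; case: ifP => i0.
  congr (_ + _); apply: eq_bigr => j _.
  by rewrite [RHS]slcoefZ tr i0 subSS -scalerAl.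
by rewrite big1 ?addr0 // => j _; rewrite slcoefZ tr i0 mulr0.
Qed.

(** The argument is the first row of [companion u *m d] minus that of [h (d L)],
for the matrix [d] with rows [rr m], ..., [rr 0].  Combining the rows with the
coefficients of [L] reassembles [L] itself, and the remainders add up to the
positive part of [L g] by [psipos_Lop_mul]. *)
Lemma row_op_first_row :
  row_op (\sum_(j < n) - u j *: rr (m - j) - rr n) =
  L * psipos (g * L) - psipos (L * g) * L.
Proof.
rewrite row_opD row_opN row_op_sum.
under eq_bigr => j _ do rewrite row_opZ scaleNr row_op_rr ?(leq_trans (leq_subr _ _)) //.
rewrite (row_op_rr (leqnn n)) sumrN -opprD psipos_Lop_mul -[psipos _]opprK -row_op_rr0 mulrN -opprD.
congr (- _); set w := row_op (rr 0).
pose S := \sum_(j < n) u j *: Dp (m - j)%N.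
pose G := \sum_(j < n) u j *: (Dp (m - j)%N * gtrunc (m - j)).
have -> : \sum_(j < n) u j *: (Dp (m - j)%N * (w + gtrunc (m - j) * L)) = S * w + G * L.
  rewrite !mulr_suml -big_split; apply: eq_bigr => j _ /=.
  by rewrite -!scalerAl -scalerDr mulrDr mulrA.
have LE : L = Dp n + S.
  by rewrite /Lop; congr (_ + _); apply: eq_bigr => j _; rewrite subSS.
rewrite -/G {3}LE [in RHS]mulrDl [X in _ = _ + X]mulrDl (mulrDr (Dp n) w) (mulrA (Dp n)).
by rewrite [RHS]addrACA addrC.
Qed.

(** Replacing positive parts by their complements changes the expression to
[(Lg)_(<=0) L - L (gL)_(<=0)], where degrees only allow one product in degree
[n]. *)
Lemma first_row_top :
  slcoef (L * psipos (g * L) - psipos (L * g) * L) n =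
  slcoef (L * g) 0 - h n (slcoef (g * L) 0).
Proof.
pose X := L * g - psipos (L * g); pose Y := g * L - psipos (g * L).
have X0 i : 0 < i -> slcoef X i = 0.
  by move=> i0; rewrite slcoefB /= i0 subrr.
have Y0 i : 0 < i -> slcoef Y i = 0.
  by move=> i0; rewrite slcoefB /= i0 subrr.
have Ln i : n%:Z < i -> slcoef L i = 0.
  by move=> i0; rewrite Lop_supp //; lia.
have -> : L * psipos (g * L) - psipos (L * g) * L = X * L - L * Y.
  by rewrite (mulrBl L) (mulrBr L) -(mulrA L g L) opprB [RHS]addrC addrA subrK.
have e1 := slcoefM_top X0 Ln; have e2 := slcoefM_top Ln Y0.
rewrite add0r in e1; rewrite addr0 in e2.
rewrite slcoefB e1 e2 Lop_coefn rmorph1 mulr1 mul1r.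
by rewrite !slcoefB /= !subr0.
Qed.

End FixedOperator.

End Operators.

(** * The reduced bracket *)

Section ReducedForm.
Variables (R : realType) (q : R[i]) (m : nat).
Hypothesis hq : 0 < `|q| < 1.
Local Notation C := R[i].
Local Notation n := m.+1.
Local Notation F := (laurent C).
Local Notation Psi := (PsiD hq).
Local Notation h := (hpow q).
Implicit Types (X Y A : Psi) (f a b : F).

Lemma rmconst0 a : intdz (rmconst a) = 0.
Proof. by rewrite /rmconst intdzB intdz_cst subrr. Qed.

(** The operator [1 - h^n] is injective on series without constant term, since its
kernel consists of the constants. *)
Lemma inv_1_hnE a : intdz a = 0 -> inv_1_hn hq m a = inv1h q n a.
Proof.
move=> a0; rewrite -{1}(inv1hK hq (ltn0Sn m) a0).
pose G (b : F) := b - h n b.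
rewrite -[LHS]/('pinv_(fun=> 0) (range (@psi0' _ _ hq)) G (G (inv1h q n a))).
rewrite pinvKV //.
  move=> b e; rewrite !inE => -[X _ <-] [Y _ <-] GE.
  have : h n (psi0' X - psi0' Y) = psi0' X - psi0' Y.
    move: GE; rewrite /G hpowB //; move: (psi0' X) (psi0' Y) => b1 b2 GE.
    rewrite -[X in _ = X - _](subrK (h n b1)) GE; ring.
  move=> /(hpow_fixed hq (ltn0Sn m)).
  rewrite intdzB !rmconst0 subrr scale0r => /eqP.
  by rewrite subr_eq0 => /eqP.
rewrite inE; exists ((inv1h q n a)%:A) => //.
rewrite /psi0' /rmconst /psi0 slcoef_scal eqxx mulr1 inv1h_const scale0r subr0 //.
Qed.

Variable E : F -> F.
Hypothesis EB : forall a b, E (a - b) = E a - E b.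
Hypothesis Eh : forall i a, E (h i a) = h i (E a).

Lemma psipair_opmx A A' Y Y' f1 f2 f3 f4 :
  psipair (A + f1%:A + - f2%:A) Y - psipair (f3%:A + (A' - f4%:A)) Y' =
  psipair A Y - psipair A' Y' + (intdz (f1 * psi0 Y) - intdz (f2 * psi0 Y) -
    intdz (f3 * psi0 Y') + intdz (f4 * psi0 Y')).
Proof.
rewrite (psipairDl (A + _)) (psipairDl A) (psipairDl (f3%:A)) (psipairDl A').
rewrite !psipairNl !psipair_scal -/(psi0 Y) -/(psi0 Y'); ring.
Qed.

(** The computation behind [reduced_form_eval].  Here [k], [p] stand for
[(1 - h^n)^-1 X_0] and its [h^n]-image, [r], [s] for the first two [h^n]-images of
[(1 - h^n)^-1 X'_0], [e], [e'] for the images of [X_0] and [h^n X'_0] under [E],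
and [b], [b'] for [Y_0] and [h^n Y'_0], where the common constant term [c] has been
removed from [X_0] and [X'_0]. *)
Lemma reduced_form_alg (k p r s e e' b b' : F) (c : C) : intdz (b - b') = 0 ->
  2^-1 * intdz ((k + p) * b) + intdz (e * b) - (intdz (r * b) + intdz (e' * b)) -
    (intdz (p * b') + intdz (e * b')) +
    (2^-1 * intdz ((r + s) * b') + intdz (e' * b')) =
  2^-1 * intdz ((k - r + (p - s)) * (b - b')) + intdz ((e - e') * (b - b')) +
  2^-1 * (intdz ((k - p - (r - s)) * b') - intdz ((b - b') * (r - s + c%:A))).
Proof.
move=> bb0.
have gen (J : F -> F -> C) : (forall x y z, J (x + y) z = J x z + J y z) ->
    (forall x z, J (- x) z = - J x z) -> (forall x y, J x y = J y x) ->
    J (b - b') c%:A = 0 ->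
    2^-1 * J (k + p) b + J e b - (J r b + J e' b) - (J p b' + J e b') +
      (2^-1 * J (r + s) b' + J e' b') =
    2^-1 * J (k - r + (p - s)) (b - b') + J (e - e') (b - b') +
    2^-1 * (J (k - p - (r - s)) b' - J (b - b') (r - s + c%:A)).
  move=> JD JN JC Jc.
  have JDr x y z : J z (x + y) = J z x + J z y by rewrite !(JC z) JD.
  have JNr x z : J z (- x) = - J z x by rewrite !(JC z) JN.
  rewrite (JDr _ c%:A) Jc addr0 !(JD, JN, JDr, JNr) (JC b r) (JC b s) (JC b' r) (JC b' s).
  by field.
apply: (gen (fun x y => intdz (x * y))) => [x y z|x z|x y|].
- by rewrite mulrDl intdzD.
- by rewrite mulNr intdzN.
- by rewrite mulrC.
- by rewrite mulrC intdz_scalA bb0 mulr0.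
Qed.

(** The part of the reduced bracket of degree zero is half the Cayley transform
of [h^n], plus [E], applied to the single series [Z] and paired with [Z'], up to
a skew term; this has the same shape as the loop bracket. *)
Lemma reduced_form_eval X X' Y Y' :
  intdz (psi0 X) = intdz (psi0 X') -> intdz (psi0 Y) = intdz (psi0 Y') ->
  let Z := psi0 X - h n (psi0 X') in
  let Z' := psi0 Y - h n (psi0 Y') in
  pair2 (@psipair _ _ hq)
    (opmx2 (fun A => Rop A + (op_half hq m E (psi0' A))%:A)
           (fun A => - (op_plus hq m E (hpow q n (psi0' A)))%:A)
           (fun A => (op_minus hq m E (hpow q (- n%:Z) (psi0' A)))%:A)
           (fun A => Rop A - (op_half hq m E (psi0' A))%:A) (X, X')) (Y, Y') =
  psipair (Rop X) Y - psipair (Rop X') Y' +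
  (2^-1 * intdz ((inv1h q n Z + h n (inv1h q n Z)) * Z') + intdz (E Z * Z')) +
  2^-1 * (intdz (Z * h n (psi0 Y')) - intdz (Z' * h n (psi0 X'))).
Proof.
move=> XX YY Z Z'; rewrite /pair2 /opmx2 /=.
set a := psi0' X; set a' := psi0' X'.
have a0 : intdz a = 0 by apply: rmconst0.
have a'0 : intdz a' = 0 by apply: rmconst0.
rewrite psipair_opmx -[RHS]addrA; congr (_ + _).
have [k kE] : exists k, k = inv1h q n a by eexists.
have [k' k'E] : exists k', k' = inv1h q n a' by eexists.
have [b bE] : exists b, b = psi0 Y by eexists.
have [b' b'E] : exists b', b' = h n (psi0 Y') by eexists.
pose c := intdz (psi0 X').
have Xa : psi0 X = a + c%:A by rewrite /a /psi0' /rmconst XX subrK.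
have Xa' : psi0 X' = a' + c%:A by rewrite /a' /psi0' /rmconst subrK.
have hX' : h n (psi0 X') = h n a' + c%:A by rewrite Xa' hpowDr // hpow_cst.
have ak : a = k - h n k by rewrite kE inv1hK.
have ak' : h n a' = h n k' - h n (h n k') by rewrite -hpowB // k'E inv1hK.
have ZE : Z = a - h n a' by rewrite /Z hX' Xa opprD addrACA subrr addr0.
have KZ : inv1h q n Z = k - h n k' by rewrite ZE inv1hB inv1h_hpow kE k'E.
have hKZ : h n (inv1h q n Z) = h n k - h n (h n k') by rewrite KZ hpowB.
have [e' e'E] : exists e', e' = E (h n a') by eexists.
have EZ : E Z = E a - e' by rewrite ZE EB e'E.
have ZE' : Z = k - h n k - (h n k' - h n (h n k')) by rewrite ZE ak' {1}ak.
have sh f : intdz (f * psi0 Y') = intdz (h n f * b').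
  by rewrite b'E -hpowM // intdz_hpow.
have Z'0 : intdz (b - b') = 0 by rewrite bE b'E intdzB intdz_hpow YY subrr.
have ha'0 : intdz (h n a') = 0 by rewrite intdz_hpow.
have ha0 : intdz (h (- n%:Z) a) = 0 by rewrite intdz_hpow.
have D f g y : intdz ((f + g) * y) = intdz (f * y) + intdz (g * y).
  by rewrite mulrDl intdzD.
have DS f g y : intdz (((2^-1 : C) *: f + g) * y) = 2^-1 * intdz (f * y) + intdz (g * y).
  by rewrite mulrDl intdzD -scalerAl intdzZ.
have t1 : intdz (op_half hq m E a * b) =
    2^-1 * intdz ((k + h n k) * b) + intdz (E a * b).
  by rewrite /op_half (inv_1_hnE a0) -kE; exact: DS.
have t2 : intdz (op_plus hq m E (h n a') * b) =
    intdz (h n k' * b) + intdz (e' * b).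
  by rewrite /op_plus (inv_1_hnE ha'0) inv1h_hpow -k'E -e'E; exact: D.
have t3 : intdz (op_minus hq m E (h (- n%:Z) a) * psi0 Y') =
    intdz (h n k * b') + intdz (E a * b').
  rewrite /op_minus (inv_1_hnE ha0) inv1h_hpow (hpowK hq) -kE.
  apply: etrans (D _ _ _) _; congr (_ + _); first exact: sh.
  by apply: etrans (sh _) _; rewrite -Eh (hpowK hq).
have t4 : intdz (op_half hq m E a' * psi0 Y') =
    2^-1 * intdz ((h n k' + h n (h n k')) * b') + intdz (e' * b').
  rewrite /op_half (inv_1_hnE a'0) -k'E; apply: etrans (DS _ _ _) _.
  apply: (congr2 (fun x y => 2^-1 * x + y)).
    by apply: etrans (sh _) _; rewrite (hpowDr hq).
  by apply: etrans (sh _) _; rewrite e'E Eh.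
rewrite -bE t1 t2 t3 t4 hKZ KZ EZ ZE' hX' ak' /Z' -bE -b'E.
exact: reduced_form_alg.
Qed.

End ReducedForm.

(** * The normal form of the gradient at a companion matrix *)

Section NormalForm.
Variables (R : realType) (q : R[i]) (m : nat).
Hypothesis hq : 0 < `|q| < 1.
Local Notation C := R[i].
Local Notation n := m.+1.
Local Notation F := (laurent C).
Local Notation Lgl := 'M[F]_n.
Local Notation Psi := (PsiD hq).
Local Notation h := (hpow q).
Local Notation dgrad := (gap_grad q).
Variable u : 'I_n -> F.
Local Notation L := (Lop hq u).
Local Notation Cu := (companion u).

Lemma mxB_entry (A B : Lgl) i j : (A - B) i j = A i j - B i j.
Proof. by rewrite mxE [X in _ + X = _]mxE. Qed.

Lemma rowB_entry (v w : 'rV[F]_n) j : (v - w) 0 j = v 0 j - w 0 j.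
Proof. by rewrite mxE [X in _ + X = _]mxE. Qed.

Lemma row_entry (A : Lgl) i j : row i A 0 j = A i j.
Proof. by rewrite mxE. Qed.

Section OneGradient.
Variables (d : Lgl) (g : Psi).
Hypothesis ud : upper (dgrad Cu d).
Hypothesis g_supp : forall i : int, ~~ (- n%:Z < i <= 0) -> slcoef g i = 0.
Hypothesis col0 : forall j : 'I_n, d j ord0 = - h (m - j)%N (slcoef g (- (m - j)%N%:Z)).

(** The gap vanishes outside the first row exactly when row [i - 1] of the gradient
is [h] of (row [i] times the companion matrix); the last row is kept. *)
Definition normal_row (k : nat) : 'rV[F]_n :=
  iter k (fun v => map_mx (h 1) (v *m Cu)) (row ord_max d).
Definition normal_form : Lgl := \matrix_(i < n) normal_row (m - i).

Lemma normal_rowS k : normal_row k.+1 = map_mx (h 1) (normal_row k *m Cu). Proof. by []. Qed.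

(** On and below the diagonal the recursion only involves entries on and below the
diagonal, where [d] satisfies it because its gap is upper triangular. *)
Lemma normal_form_lower (i j : 'I_n) : (j <= i)%N -> normal_form i j = d i j.
Proof.
move: {2}(m - i)%N (erefl (m - i)%N) => k; elim: k i j => [|k IHk] i j ik ji.
  have -> : i = ord_max by apply: val_inj; have := ltn_ord i; rewrite /=; lia.
  by rewrite mxE /= subnn mxE.
have im : (i.+1 < n)%N by lia.
pose i1 := Ordinal im; have ik1 : (m - i1)%N = k by rewrite /=; lia.
have dE : d i j = h 1 ((d *m Cu) i1 j).
  have := ud (i := i1) (j := j) ji; rewrite /gap_grad mxB_entry => /eqP.
  rewrite subr_eq0 => /eqP; rewrite -[(d *m Cu) i1 j]/(right_grad Cu d i1 j) => <-.
  rewrite hmxE hpowK // -!row_entry.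
  by rewrite (@companion_mul_row R m u d i1 i).
rewrite dE mxE ik normal_rowS mxE; congr (h 1 _).
rewrite !mxE; apply: eq_bigr => l _.
have nE : normal_row k 0 l = normal_form i1 l by rewrite mxE ik1.
rewrite nE; case: (leqP l i1) => li; first by rewrite IHk.
by rewrite (companion_sub hq) ?gtn_eqF ?mulr0 //; move: li; rewrite /=; lia.
Qed.

Lemma normal_form_strictly_upper : strictly_upper (normal_form - d).
Proof. by move=> i j ji; rewrite mxB_entry normal_form_lower // subrr. Qed.

Lemma right_grad_normal_form (i j : 'I_n) :
  right_grad Cu normal_form i j = h (-1) (normal_row (m - i).+1 0 j).
Proof.
rewrite normal_rowS [X in h _ X]mxE hpowVK // !mxE; apply: eq_bigr => l _.
by rewrite mxE.
Qed.

(** The image under [h] of the first row of the gap of [normal_form]. *)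
Definition gap_row : 'rV[F]_n := \sum_(j < n) - u j *: normal_row (m - j) - normal_row n.

Lemma gap_grad_normal_form (i j : 'I_n) :
  dgrad Cu normal_form i j = if i == ord0 then h (-1) (gap_row 0 j) else 0.
Proof.
rewrite /gap_grad mxB_entry right_grad_normal_form hmxE -hpowB //.
case: (eqVneq i ord0) => [->|i0].
  rewrite subn0; congr (h _ _); rewrite /gap_row rowB_entry; congr (_ - _).
  rewrite summxE mxE; apply: eq_bigr => l _.
  by rewrite [RHS]mxE [Cu _ _]mxE eqxx [normal_form _ _]mxE.
have i0' : (0 < i)%N by rewrite lt0n.
have im := ltn_ord i.
have i1 : (i.-1 < n)%N by lia.
have -> : (Cu *m normal_form) i j = normal_row (m - i).+1 0 j.
  rewrite -row_entry (@companion_mul_row R m u normal_form i (Ordinal i1)) /=.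
    by rewrite row_entry mxE /= (_ : (m - i.-1 = (m - i).+1)%N) //; lia.
  by rewrite prednK.
by rewrite subrr hpow_0.
Qed.

Lemma gap_grad_normal_form_upper : upper (dgrad Cu normal_form).
Proof.
by move=> i j ji; rewrite gap_grad_normal_form; case: eqVneq => // i0; rewrite i0 in ji.
Qed.

Lemma normal_row_col0 (k : nat) : (k <= m)%N -> normal_row k 0 ord0 = - h k (slcoef g (- k%:Z)).
Proof.
move=> km; have mk : (m - k < n)%N by lia.
have := normal_form_lower (leq0n (Ordinal mk) : ((ord0 : 'I_n) <= Ordinal mk)%N).
by rewrite mxE /= subKn // col0 /= subKn.
Qed.

Definition gap_op : Psi := L * psipos (g * L) - psipos (L * g) * L.

Lemma row_op_gap_row : row_op hq gap_row = gap_op.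
Proof. exact: (row_op_first_row g_supp normal_rowS normal_row_col0). Qed.

Definition gap_top : F := psi0 (L * g) - h n (psi0 (g * L)).

Lemma gap_row0 : gap_row 0 ord0 = gap_top.
Proof.
have := row_op_coef hq gap_row ord0; rewrite row_op_gap_row => <-.
exact: first_row_top.
Qed.

Lemma intdz_gap_top : intdz gap_top = 0.
Proof.
rewrite /gap_top intdzB intdz_hpow -[intdz (psi0 (L * g))]/(psiTr (L * g)).
by rewrite psiTr_mulC subrr.
Qed.

(** Row [j] of [d L] is row [j - 1] of [d] up to a dilation; for [j = 0] it
continues the recursion one step beyond the matrix. *)
Lemma right_grad_normal_form_col0 (j : 'I_n) : h 1 (right_grad Cu normal_form j ord0) =
  if j == ord0 then h n (psi0 (g * L)) else - h (n - j)%N (slcoef g (- (n - j)%N%:Z)).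
Proof.
rewrite right_grad_normal_form hpowK //; case: (eqVneq j ord0) => [->|j0].
  rewrite subn0 -(row_op_coef hq _ ord0) (row_op_rr g_supp normal_rowS normal_row_col0 (leqnn n)).
  rewrite subn0 coefDpM subrr slcoefD row_op_supp // add0r.
  by rewrite gtruncn.
have j0' : (0 < j)%N by rewrite lt0n.
have jn := ltn_ord j.
have -> : (m - j).+1 = (n - j)%N by lia.
by rewrite normal_row_col0 //; lia.
Qed.

Lemma diag_row_gap_grad_normal_form : diag_row (dgrad Cu normal_form) =
  \row_(i < n) if i == ord0 then h (-1) gap_top else 0.
Proof.
apply/rowP => i; rewrite [LHS]mxE [RHS]mxE gap_grad_normal_form.
by case: eqVneq => [->|//]; rewrite gap_row0.
Qed.

End OneGradient.

Section TwoGradients.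
Variables (d e : Lgl) (g k : Psi).
Hypothesis ud : upper (dgrad Cu d).
Hypothesis ue : upper (dgrad Cu e).
Hypothesis g_supp : forall i : int, ~~ (- n%:Z < i <= 0) -> slcoef g i = 0.
Hypothesis k_supp : forall i : int, ~~ (- n%:Z < i <= 0) -> slcoef k i = 0.
Hypothesis gcol0 : forall j : 'I_n, d j ord0 = - h (m - j)%N (slcoef g (- (m - j)%N%:Z)).
Hypothesis kcol0 : forall j : 'I_n, e j ord0 = - h (m - j)%N (slcoef k (- (m - j)%N%:Z)).

Lemma psipair_gap_op : psipair (gap_op g) k =
  psipair (psipos (g * L)) (k * L) - psipair (psipos (L * g)) (L * k).
Proof. by rewrite /gap_op psipairBl psipair_cyc psipairA. Qed.

(** Only the first row of the gap is nonzero, so only the first column of the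
right gradient is needed.  Its entries below the top are coefficients of [k],
which gives the trace of [gap_op g * k] up to sign; the top entry is the
additional term. *)
Lemma mxpair_first_row :
  mxpair (dgrad Cu (normal_form d)) (right_grad Cu (normal_form e)) =
  intdz (gap_top g * h n (psi0 (k * L))) - psipair (gap_op g) k.
Proof.
rewrite mxpairE (bigD1 ord0) //= [X in _ + X]big1 ?addr0; last first.
  move=> i /negPf i0; apply: big1 => j _.
  by rewrite gap_grad_normal_form i0 mul0r intdz0.
rewrite -(row_op_gap_row ud g_supp gcol0) row_op_pair.
have zE (j : 'I_n) :
    intdz (dgrad Cu (normal_form d) ord0 j * right_grad Cu (normal_form e) j ord0) =
    intdz (gap_row d 0 j * h 1 (right_grad Cu (normal_form e) j ord0)).
  rewrite gap_grad_normal_form // eqxx -(intdz_hpow q 1) hpowM // hpowK //.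
rewrite (eq_bigr _ (fun j _ => zE j)) (bigD1 ord0) //= [in RHS](bigD1 ord0) //=.
rewrite (right_grad_normal_form_col0 ue k_supp kcol0) eqxx (gap_row0 ud g_supp gcol0).
rewrite [slcoef k _]k_supp; last by rewrite subn0; lia.
rewrite hpow_0 // mulr0 intdz0 add0r; congr (_ + _).
rewrite -sumrN; apply: eq_bigr => j /negPf j0.
by rewrite (right_grad_normal_form_col0 ue k_supp kcol0) j0 mulrN intdzN.
Qed.

End TwoGradients.

End NormalForm.

(** * Comparison of the two brackets *)

Section Comparison.
Variables (R : realType) (q : R[i]) (m : nat).
Hypothesis hq : 0 < `|q| < 1.
Local Notation C := R[i].
Local Notation n := m.+1.
Local Notation F := (laurent C).
Local Notation Lgl := 'M[F]_n.
Local Notation Psi := (PsiD hq).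
Local Notation h := (hpow q).
Local Notation dgrad := (gap_grad q).
Local Notation hshift := (hshift q).
Local Notation usum := (twisted_sum q).
Variable Delta : Lgl -> Lgl.
Hypothesis hDelta : skew_operator_in_Un q Delta.
Local Notation E := (End_Un_laurent q Delta).
Local Notation rhat := (rhat q Delta).

Definition row0 (y : F) : 'rV[F]_n := \row_i if i == ord0 then y else 0.

Lemma twisted_sum_row0 y : usum (row0 y) = y.
Proof.
rewrite /twisted_sum (bigD1 ord0) //= mxE eqxx hpow_id big1 ?addr0 // => i /negPf i0.
by rewrite mxE i0 hpow_0.
Qed.

Lemma diagpair_row0 (v : 'rV[F]_n) y : diagpair v (row0 y) = intdz (v 0 ord0 * y).
Proof.
rewrite /diagpair (bigD1 ord0) //= [row0 y _ _]mxE eqxx big1 ?addr0 // => i /negPf i0.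
by rewrite mxE i0 mulr0 intdz0.
Qed.

Definition geometric_row (k : F) : 'rV[F]_n := \row_i if i == ord0 then k else h (n - i)%N k.

Lemma hshift_geometric_row k : hshift (geometric_row k) = \row_i h (n - i)%N k.
Proof.
apply/rowP => i; rewrite [LHS]mxE [RHS]mxE.
have := ltn_ord i; rewrite ltnS leq_eqVlt => /orP[/eqP im|im].
  have -> : ordS i = ord0 by apply: val_inj; rewrite /= im modnn.
  by rewrite mxE eqxx im subSnn.
have Si : ordS i = i.+1 :> nat by rewrite /= modn_small.
rewrite mxE (_ : (ordS i == ord0) = false); last first.
  by rewrite -(inj_eq val_inj) [val (ordS i)]Si.
by rewrite hpow_hpow // Si; congr hpow; lia.
Qed.

(** Around the cycle, [1 - h tau] becomes [1 - h^n] on the first entry. *)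
Lemma geometric_row_solve k y : k - h n k = y ->
  geometric_row k - hshift (geometric_row k) = row0 y.
Proof.
move=> ky; rewrite hshift_geometric_row; apply/rowP => i.
rewrite rowB_entry [geometric_row _ _ _]mxE [X in _ - X]mxE [RHS]mxE.
by case: (eqVneq i ord0) => [->|_]; rewrite ?subn0 ?ky // subrr.
Qed.

Lemma rhat_row0 (A B : Lgl) z z' : upper A -> upper B -> vtrace (diag_row B) = 0 ->
  intdz z = 0 -> diag_row A = row0 (h (-1) z) -> diag_row B = row0 (h (-1) z') ->
  mxpair (rhat A) B =
  2^-1 * intdz ((inv1h q n z + h n (inv1h q n z)) * z') + intdz (E z * z').
Proof.
move=> uA uB trB z0 Az Bz.
pose k := inv1h q n (h (-1) z).
have ky : k - h n k = h (-1) z by rewrite /k inv1hK // intdz_hpow.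
have sh (f g : F) : intdz (h (-1) f * h (-1) g) = intdz (f * g).
  by rewrite -hpowM // intdz_hpow.
apply: etrans (rhat_upper hq hDelta uA uB) _.
rewrite Az -(geometric_row_solve ky); apply: etrans (rhat0_pair hq hDelta _ trB) _.
rewrite (geometric_row_solve ky) Bz !twisted_sum_row0 diagpair_row0 hshift_geometric_row.
rewrite [X in intdz (X * _)]mxE [geometric_row _ _ _]mxE eqxx mxE subn0.
rewrite (End_hpow hq hDelta); apply: (congr2 (fun x y => 2^-1 * x + y)); last exact: sh.
rewrite /k inv1h_hpow -[RHS]sh hpowDr // !hpow_hpow //; congr (intdz ((_ + _) * _)).
Qed.

Lemma psipair_Rop (X Y : Psi) :
  psipair (Rop X) Y = 2^-1 * (psipair (psipos X) Y - psipair (psipos Y) X).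
Proof.
rewrite /Rop psipairZl intdzVn -[intdz _]/(psipair (psipos X - psineg X) Y) psipairBl.
by rewrite (psipairC (psineg X)) -psipair_pos.
Qed.

Variable u : 'I_n -> F.
Local Notation L := (Lop hq u).
Local Notation Cu := (companion u).

Lemma is_psigrad_supp (phi : Psi -> C) (M g : Psi) : is_psigrad m phi M g ->
  forall i : int, ~~ (- n%:Z < i <= 0) -> slcoef g i = 0.
Proof.
move=> [[f ->] _] i iN; rewrite slcoef_sum big1 // => j _.
rewrite slcoefZ coefDp (_ : _ == _ = false) ?mulr0 //.
by apply/negbTE; apply: contra iN => /eqP ->; have := ltn_ord j; lia.
Qed.

Lemma loop_form_reduced (d e : Lgl) (g k : Psi) :
  upper (dgrad Cu d) -> upper (dgrad Cu e) ->
  (forall i : int, ~~ (- n%:Z < i <= 0) -> slcoef g i = 0) ->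
  (forall i : int, ~~ (- n%:Z < i <= 0) -> slcoef k i = 0) ->
  (forall j : 'I_n, d j ord0 = - h (m - j)%N (slcoef g (- (m - j)%N%:Z))) ->
  (forall j : 'I_n, e j ord0 = - h (m - j)%N (slcoef k (- (m - j)%N%:Z))) ->
  pair2 (@psipair _ _ hq)
    (opmx2 (fun A => Rop A + (op_half hq m E (psi0' A))%:A)
           (fun A => - (op_plus hq m E (hpow q n (psi0' A)))%:A)
           (fun A => (op_minus hq m E (hpow q (- n%:Z) (psi0' A)))%:A)
           (fun A => Rop A - (op_half hq m E (psi0' A))%:A) (L * g, g * L))
    (L * k, k * L) = loop_form q Delta Cu d e.
Proof.
move=> ud ue gs ks gc kc.
have trLg : intdz (psi0 (L * g)) = intdz (psi0 (g * L)) by exact: psiTr_mulC.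
have trLk : intdz (psi0 (L * k)) = intdz (psi0 (k * L)) by exact: psiTr_mulC.
have RE := reduced_form_eval m (EndB hq hDelta) (End_hpow hq hDelta) trLg trLk.
cbv zeta in RE; apply: (etrans RE).
rewrite -/(gap_top u g) -/(gap_top u k).
have uN d' := gap_grad_normal_form_upper hq u d'.
have S1 := loop_form_mod_strictly_upper hq hDelta (companion_sub hq u) ud ue
  (normal_form_strictly_upper hq ud) (normal_form_strictly_upper hq ue).
apply: etrans _ S1.
have E1 := rhat_row0 (uN d) (uN e) (vtrace_gap_grad q Cu (normal_form q u e))
  (intdz_gap_top u g) (diag_row_gap_grad_normal_form ud gs gc)
  (diag_row_gap_grad_normal_form ue ks kc).
have E2 := mxpair_first_row ud ue gs ks gc kc.
have E3 := mxpair_first_row ue ud ks gs kc gc.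
(* The pairing of the two right gradients cancels. *)
have E4 (a b A B : Lgl) : mxpair (a + A) B - mxpair A (b + B) = mxpair a B - mxpair b A.
  by rewrite mxpairDl mxpairDr (mxpairC A b); ring.
have lE d' : left_grad q Cu d' = dgrad Cu d' + right_grad Cu d' by rewrite subrK.
rewrite /loop_form (lE (normal_form q u d)) (lE (normal_form q u e)).
apply: etrans _ (esym (congr2 (fun x y => x + 2^-1 * y) E1
  (etrans (E4 _ _ _ _) (congr2 (fun x y => x - y) E2 E3)))).
rewrite !psipair_gap_op !psipair_Rop.
move: (intdz (gap_top u g * _)) (intdz (gap_top u k * _)) => w1 w2.
move: (intdz (_ * _)) (intdz (_ * _)) => w3 w4.
move: (psipair (psipos (L * g)) _) (psipair (psipos (L * k)) _) => v1 v2.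
move: (psipair (psipos (g * L)) _) (psipair (psipos (k * L)) _) => v3 v4.
ring.
Qed.

End Comparison.

Theorem theorem2p10 (R : realType) (q : R[i]) (hq : 0 < `|q| < 1) (m : nat)
    (Delta : 'M[laurent R[i]]_m.+1 -> 'M[laurent R[i]]_m.+1)
    (hDelta : skew_operator_in_Un q Delta) :
  DS_reduces_to hq (mxbracket q Delta)
    (psibracket hq m (End_Un_laurent q Delta)).
Proof.
move=> phi psi phih psih sphi spsi sphih spsih iphih ipsih phiE psiE L YL.
have [S [u [uS Su rhoL]]] := rho_ex hq YL.
have Mu : Mn m (Lop hq u) by exists u.
have phiG := psigradP sphi Mu; have psiG := psigradP spsi Mu.
have phihG := mxgradP (companion u) sphih; have psihG := mxgradP (companion u) spsih.
have ud := gap_grad_upper hq (companion u) sphih iphih.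
have ue := gap_grad_upper hq (companion u) spsih ipsih.
rewrite rhoL mxbracketE // (mxgrad_gauge L sphih iphih uS) (mxgrad_gauge L spsih ipsih uS).
apply: etrans _ (esym (loop_form_gauge hq hDelta uS _ _)); rewrite Su //.
apply: loop_form_reduced => //.
- exact: is_psigrad_supp phiG.
- exact: is_psigrad_supp psiG.
- exact: mxgrad_col0 phiE phihG phiG.
- exact: mxgrad_col0 psiE psihG psiG.
Qed.
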